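(* Let $R$ be a semilocal zero-dimensional ring, and let $X_1,\ldots,X_n$ be indeterminates for $R$. Then the following are equivalent: (1) $R$ is perfect. (2) $R[X_1,\ldots,X_n]$ is subperfect. (3) $R[X_1,\ldots,X_n]$ is $n$-subperfect. (4) For each sequence $\{I_i\}_{i=1}^\infty$ of finitely generated ideals of $R$ contained in the Jacobson radical $J$ of $R$, there exists $k>0$ such that $I_1I_2\cdots I_k=0$.
   Context: All rings are commutative with identity. A ring is semilocal if it has only finitely many maximal ideals. A ring is perfect if every flat module over it is projective (equivalently, it satisfies the descending chain condition on principal ideals). $Q(A)$ denotes the total quotient ring of a ring $A$, and $A$ is subperfect if $Q(A)$ is perfect. A sequence $x_1,\ldots,x_i$ in $A$ is a regular sequence if $(x_1,\ldots,x_i)A\neq A$ and each $x_j$ is a non-zero-divisor on $A/(x_1,\ldots,x_{j-1})A$; the empty sequence is considered a regular sequence. A ring $A$ is regularly subperfect if for each regular sequence $x_1,\ldots,x_i$ in $A$ (including the empty one) the ring $A/(x_1,\ldots,x_i)A$ is subperfect. For an integer $n\ge 0$, $A$ is $n$-subperfect if $A$ is regularly subperfect and every maximal regular sequence in $A$ has length $n$. *)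

(* Defs.v *)
From HB Require Import structures.
From mathcomp Require Import all_boot all_algebra.
From mathcomp Require Import boolp classical_sets cardinality.
From mathcomp Require Import ring.

Set Implicit Arguments.
Unset Strict Implicit.
Unset Printing Implicit Defensive.

Import GRing.Theory.

Local Open Scope ring_scope.
Local Open Scope quotient_scope.
Local Open Scope classical_set_scope.

Definition is_ideal (A : comNzRingType) (I : set A) : Prop :=
  [/\ I 0,
      forall x y, I x -> I y -> I (x + y)
    & forall a x, I x -> I (a * x)].

Definition prime_ideal (A : comNzRingType) (P : set A) : Prop :=
  [/\ is_ideal P, ~ P 1 & forall x y, P (x * y) -> P x \/ P y].

Definition maximal_ideal (A : comNzRingType) (M : set A) : Prop :=
  [/\ is_ideal M, ~ M 1
    & forall I : set A, is_ideal I -> ~ I 1 -> M `<=` I -> I = M].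

Definition ideal_gen (A : comNzRingType) (S : set A) : set A :=
  smallest (@is_ideal A) S.

Definition finitely_generated (A : comNzRingType) (I : set A) : Prop :=
  exists s : seq A, I = ideal_gen [set` s].

Definition ideal_mul (A : comNzRingType) (I J : set A) : set A :=
  ideal_gen [set x * y | x in I & y in J].

Definition jacobson_radical (A : comNzRingType) : set A :=
  \bigcap_(M in [set M | maximal_ideal M]) M.
Arguments jacobson_radical A : clear implicits.

Definition semilocal (A : comNzRingType) : Prop :=
  finite_set [set M : set A | maximal_ideal M].

Definition prime_chain (A : comNzRingType) (d : nat) (P : nat -> set A) : Prop :=
  (forall i, (i <= d)%N -> prime_ideal (P i)) /\
  (forall i, (i < d)%N -> P i `<` P i.+1).

Definition has_krull_dim (A : comNzRingType) (d : nat) : Prop :=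
  (exists P : nat -> set A, prime_chain d P) /\
  (forall (e : nat) (P : nat -> set A), prime_chain e P -> (e <= d)%N).

Lemma ideal_gen_is_ideal (A : comNzRingType) (S : set A) :
  is_ideal (ideal_gen S).
Proof.
split=> [I [[]//]|x y Ix Iy I [iI sI]|a x Ix I [iI sI]].
- by case: (iI) => _ + _; apply; [apply: Ix|apply: Iy].
- by case: (iI) => _ _; apply; apply: Ix.
Qed.

(* [is_tensor_product t] : the pair (T, t) satisfies the universal property of
   the tensor product of U and V over R. *)
Definition is_tensor_product (R : comNzRingType) (U V T : lmodType R)
    (t : {bilinear U -> V -> T}) : Prop :=
  forall (W : lmodType R) (b : {bilinear U -> V -> W}),
    exists h : {linear T -> W},
      (forall u v, h (t u v) = b u v) /\
      (forall h' : {linear T -> W}, (forall u v, h' (t u v) = b u v) -> h' =1 h).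

(* [g] is the map induced by [f] on the tensor products with M: flatness says
   that tensoring with M preserves injectivity. *)
Definition flat (R : comNzRingType) (M : lmodType R) : Prop :=
  forall (N N' : lmodType R) (f : {linear N -> N'})
         (T T' : lmodType R)
         (t : {bilinear N -> M -> T}) (t' : {bilinear N' -> M -> T'})
         (g : {linear T -> T'}),
    is_tensor_product t -> is_tensor_product t' ->
    (forall x m, g (t x m) = t' (f x) m) ->
    injective f -> injective g.

Definition projective (R : comNzRingType) (P : lmodType R) : Prop :=
  forall (M N : lmodType R) (p : {linear M -> N}) (f : {linear P -> N}),
    (forall y, exists x, p x = y) ->
    exists h : {linear P -> M}, forall x, p (h x) = f x.

Definition perfect (R : comNzRingType) : Prop :=
  forall M : lmodType R, flat M -> projective M.

(* In a commutative ring, [GRing.lreg s] says that s is a non-zero-divisor, so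
   this is the localization at all non-zero-divisors; since these are
   cancellable, a / s = b / t reduces to a * t = s * b. *)
Module TotalQuotient.
Section TotalQuotient.
Variable A : comNzRingType.

Definition fracs := {x : A * A | `[< GRing.lreg x.2 >]}.
HB.instance Definition _ := Choice.on fracs.

Lemma den_lreg (x : fracs) : GRing.lreg (val x).2.
Proof. exact/asboolP/(valP x). Qed.

Definition frac_of (a s : A) (hs : GRing.lreg s) : fracs :=
  exist _ (a, s) (asboolT hs).

Definition equivf (x y : fracs) : bool :=
  (val x).1 * (val y).2 == (val x).2 * (val y).1.

Lemma equivf_refl : reflexive equivf.
Proof. by move=> x; rewrite /equivf mulrC. Qed.

Lemma equivf_sym : symmetric equivf.
Proof. by move=> x y; rewrite /equivf eq_sym; congr (_ == _); rewrite mulrC. Qed.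

Lemma equivf_trans : transitive equivf.
Proof.
move=> y x z /eqP xy /eqP yz; apply/eqP/(den_lreg (x := y)).
by rewrite mulrA [_ * (val x).1]mulrC xy -mulrA yz mulrCA.
Qed.

Canonical equivf_equiv := EquivRel equivf equivf_refl equivf_sym equivf_trans.

Definition type := {eq_quot equivf}.
HB.instance Definition _ : EqQuotient _ equivf type := EqQuotient.on type.
HB.instance Definition _ := Choice.on type.

Lemma equiv_repr x : (val (repr (\pi_type x))).1 * (val x).2 =
                     (val (repr (\pi_type x))).2 * (val x).1.
Proof. by apply/eqP; rewrite -/(equivf _ _) -eqmodE reprK. Qed.

Definition zerof : fracs := frac_of 0 (@GRing.lreg1 A).
Definition onef : fracs := frac_of 1 (@GRing.lreg1 A).
Definition oppf (x : fracs) : fracs := frac_of (- (val x).1) (@den_lreg x).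
Definition addf (x y : fracs) : fracs :=
  frac_of ((val x).1 * (val y).2 + (val y).1 * (val x).2)
          (GRing.lregM (@den_lreg x) (@den_lreg y)).
Definition mulf (x y : fracs) : fracs :=
  frac_of ((val x).1 * (val y).1) (GRing.lregM (@den_lreg x) (@den_lreg y)).

Definition zero : type := lift_cst type zerof.
Definition one : type := lift_cst type onef.
Definition opp := lift_op1 type oppf.
Definition add := lift_op2 type addf.
Definition mul := lift_op2 type mulf.

Canonical pi_zero_morph := PiConst zero.
Canonical pi_one_morph := PiConst one.

Lemma pi_opp : {morph \pi : x / oppf x >-> opp x}.
Proof.
move=> x; unlock opp; apply/eqmodP/eqP => /=.
by have e := equiv_repr x; rewrite mulNr mulrN [X in - X]mulrC -e mulrC.
Qed.
Canonical pi_opp_morph := PiMorph1 pi_opp.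

Lemma pi_add : {morph \pi : x y / addf x y >-> add x y}.
Proof.
move=> x y; unlock add; apply/eqmodP/eqP => /=.
have := equiv_repr x; have := equiv_repr y.
move: (repr _) (repr _) => [[a s] /= _] [[b t] /= _].
case: x y => [[c u] /= _] [[d v] /= _] ey ex.
have -> : (c * v + d * u) * (s * t) = v * t * (s * c) + u * s * (t * d).
  by ring.
by rewrite -ex -ey; ring.
Qed.
Canonical pi_add_morph := PiMorph2 pi_add.

Lemma pi_mul : {morph \pi : x y / mulf x y >-> mul x y}.
Proof.
move=> x y; unlock mul; apply/eqmodP/eqP => /=.
have := equiv_repr x; have := equiv_repr y.
move: (repr _) (repr _) => [[a s] /= _] [[b t] /= _].
case: x y => [[c u] /= _] [[d v] /= _] ey ex.
have -> : c * d * (s * t) = (s * c) * (t * d) by ring.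
by rewrite -ex -ey; ring.
Qed.
Canonical pi_mul_morph := PiMorph2 pi_mul.

Lemma addA : associative add.
Proof.
by elim/quotW=> x; elim/quotW=> y; elim/quotW=> z; rewrite !piE;
  apply/eqmodP/eqP => /=; ring.
Qed.

Lemma addC : commutative add.
Proof.
by elim/quotW=> x; elim/quotW=> y; rewrite !piE; apply/eqmodP/eqP => /=; ring.
Qed.

Lemma add0 : left_id zero add.
Proof. by elim/quotW=> x; rewrite !piE; apply/eqmodP/eqP => /=; ring. Qed.

Lemma addN : left_inverse zero opp add.
Proof. by elim/quotW=> x; rewrite !piE; apply/eqmodP/eqP => /=; ring. Qed.

HB.instance Definition _ := GRing.isZmodule.Build type addA addC add0 addN.

Lemma mulA : associative mul.
Proof.
by elim/quotW=> x; elim/quotW=> y; elim/quotW=> z; rewrite !piE;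
  apply/eqmodP/eqP => /=; ring.
Qed.

Lemma mulC : commutative mul.
Proof.
by elim/quotW=> x; elim/quotW=> y; rewrite !piE; apply/eqmodP/eqP => /=; ring.
Qed.

Lemma mul1 : left_id one mul.
Proof. by elim/quotW=> x; rewrite !piE; apply/eqmodP/eqP => /=; ring. Qed.

Lemma mulDl : left_distributive mul add.
Proof.
by elim/quotW=> x; elim/quotW=> y; elim/quotW=> z; rewrite !piE;
  apply/eqmodP/eqP => /=; ring.
Qed.

Lemma one_neq0 : one != zero.
Proof.
apply/eqP; rewrite !piE => /eqmodP/eqP /=.
by rewrite mulr1 mulr0 => /eqP; rewrite oner_eq0.
Qed.

HB.instance Definition _ :=
  GRing.Zmodule_isComNzRing.Build type mulA mulC mul1 mulDl one_neq0.

End TotalQuotient.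
End TotalQuotient.
HB.export TotalQuotient.

Definition total_quotient (A : comNzRingType) : comNzRingType :=
  TotalQuotient.type A.

Definition subperfect (A : comNzRingType) : Prop := perfect (total_quotient A).

Section QuotientRing.
Variables (A : comNzRingType) (I : set A).

Definition ideal_pred of is_ideal I & ~ I 1 : A -> bool := fun x => `[< I x >].

Hypotheses (idI : is_ideal I) (properI : ~ I 1).

Lemma ideal_pred_closed : idealr_closed (ideal_pred idI properI).
Proof.
case: (idI) => I0 ID IM; split; first exact/asboolP.
  exact/asboolPn.
by move=> a x y /asboolP Ix /asboolP Iy; apply/asboolP/ID => //; apply: IM.
Qed.

HB.instance Definition _ :=
  isIdealr.Build A (ideal_pred idI properI) ideal_pred_closed.

Definition quotient_ring : comNzRingType :=
  {ideal_quot (ideal_pred idI properI : idealr A)}.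

End QuotientRing.

Definition regular_sequence (A : comNzRingType) (s : seq A) : Prop :=
  ~ ideal_gen [set` s] 1 /\
  forall j, (j < size s)%N -> forall a,
    ideal_gen [set` take j s] (s`_j * a) -> ideal_gen [set` take j s] a.

Definition regularly_subperfect (A : comNzRingType) : Prop :=
  forall (s : seq A) (reg_s : regular_sequence s),
    subperfect (quotient_ring (ideal_gen_is_ideal [set` s]) (proj1 reg_s)).

Definition maximal_regular_sequence (A : comNzRingType) (s : seq A) : Prop :=
  regular_sequence s /\ forall x, ~ regular_sequence (rcons s x).

Definition n_subperfect (n : nat) (A : comNzRingType) : Prop :=
  regularly_subperfect A /\
  forall s : seq A, maximal_regular_sequence s -> size s = n.

(* Main.v *)
Require Import Defs.
From HB Require Import structures.
From mathcomp Require Import all_boot all_algebra.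
From mathcomp Require Import boolp classical_sets functions cardinality.
From mathcomp Require Import ring.
From mathcomp Require Import mpoly.

Set Implicit Arguments.
Unset Strict Implicit.
Unset Printing Implicit Defensive.

Import GRing.Theory Pdiv.Ring.

Local Open Scope ring_scope.
Local Open Scope quotient_scope.
Local Open Scope classical_set_scope.

(** All four conditions say that the nilradical of [R] is T-nilpotent: every
    product of a sequence of nilpotent elements vanishes after finitely many
    factors ([nil_tnilp]).  In dimension zero the Jacobson radical is the
    nilradical ([dim0_jacobson]), so the last condition, applied to principal
    ideals, gives T-nilpotence; the converse is Koenig's lemma: if no product of
    the ideals vanished, the finitely branching tree of the nonzero products of
    their generators would have an infinite branch ([koenig_killed]).

    Perfection of [R], of the total quotient ring of [R[X]] or of that of
    [R[X] / (0)] gives T-nilpotence by an argument of Bass.  The colimit of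
    [C -> C -> C -> ...], where the maps are the multiplications by the terms
    of a sequence [a], is flat; if it is projective, then the partial products
    satisfy [p_n = p_(n+1) c] for some [n] ([perfect_dcc]).  When [a_n] is
    nilpotent, [1 - a_n c] is a unit and [p_n = 0].

    For the converse, call an idempotent [e] local when [e C] is a local ring
    with nil maximal ideal.  If [1] is a sum of local idempotents for which
    these maximal ideals are T-nilpotent, then [C] is perfect: over such a
    local ring, lifting a basis of [M / m M] gives a basis of the flat module
    [M] ([flat_indep], [indep_set_span], [local_lift]).  Such idempotents are
    found by splitting [1] until a chain condition on products, modulo a
    T-nilpotent ideal, stops the process ([dcc_mod_local_decomp]).  A semilocal
    ring of dimension zero satisfies this condition modulo its nilradical.

    It remains to study [S / (f_1, ..., f_j)] for a regular sequence of
    [S = R[X_1, ..., X_n]], one local idempotent [e] of [R] at a time.  The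
    [e]-part [B] of this ring is finite and flat over a polynomial ring [A] in
    [n - j] variables over [R] ([weakly_regular_normalized]); this is Noether
    normalization, and passing from [j] to [j + 1] goes as follows.  The powers
    of the next element [g] are linearly dependent over [A] modulo [m], and [g]
    is regular on [B / m B] because a socle element [z] of [e R] identifies
    [B / m B] with [z B]; so [g] divides in [B] some [h] in [A] outside [m A]
    ([regular_multiple]).  A change of variables and the nilpotence of [m] give
    a multiple of [h] that is monic in one variable ([noether_multiple]).  The
    quotient [B / g B] is then finite over the polynomial ring in the other
    variables, and it is flat because [g], a divisor of a monic polynomial, is
    regular modulo every ideal of that ring ([quotient_flatmod]).

    When no variable is left, the same divisibility makes [g] a unit, so a
    regular sequence has at most [n] terms ([regular_too_long]); when a variable
    is left, it extends the sequence ([regular_extend]).  Finally, linear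
    dependence of partial products over [A] is the chain condition for the
    total quotient ring of [S / (f_1, ..., f_j)], modulo the T-nilpotent ideal
    generated by the nilpotents of [R] ([regular_chain]); hence this ring of
    fractions is perfect ([fraction_perfect]). *)

(** * Linear maps and quotient modules *)

Section LinearConstructions.
Variable R : comNzRingType.
Implicit Types (U V W : lmodType R).

Definition linear_map U V (f : U -> V) (fl : linear f) : {linear U -> V} :=
  HB.pack f (GRing.isLinear.Build R U V *:%R f fl).

Definition bilinear_map U V W (f : U -> V -> W)
    (fl : bilinear_for *:%R *:%R f) : {bilinear U -> V -> W} :=
  HB.pack f (bilinear_isBilinear.Build R U V W *:%R *:%R f fl).

(** Used to define linear maps on quotients and on modules known only through
    spanning families, where values depend on choices. *)
Lemma linear_of_graph U V (G : U -> V -> Prop) :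
  (forall u, exists v, G u v) ->
  (forall a u v u' v', G u v -> G u' v' -> G (a *: u + u') (a *: v + v')) ->
  (forall v, G 0 v -> v = 0) ->
  exists f : {linear U -> V}, forall u, G u (f u).
Proof.
move=> Gtot Glin G0; have [f Gf] := choice Gtot.
have Gfun u v v' : G u v -> G u v' -> v = v'.
  move=> Gv Gv'; apply/eqP; rewrite -subr_eq0; apply/eqP/G0.
  by have := Glin (-1) _ _ _ _ Gv' Gv; rewrite !scaleN1r addNr addrC.
have fl : linear f.
  by move=> a u v; apply: Gfun (Gf _) _; apply: Glin.
by exists (linear_map fl).
Qed.

Definition submodule V (K : set V) : Prop :=
  K 0 /\ forall a x y, K x -> K y -> K (a *: x + y).

Section QuotientModule.
Variables (V : lmodType R) (K : set V) (Ksub : submodule K).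

Definition submodule_pred of submodule K : V -> bool := fun x => `[< K x >].

Lemma submodule_predB : zmod_closed (submodule_pred Ksub).
Proof.
case: Ksub => K0 Kl; split; first exact/asboolP.
move=> x y /asboolP Kx /asboolP Ky; apply/asboolP.
by have := Kl (-1) _ _ Ky Kx; rewrite scaleN1r addrC.
Qed.

HB.instance Definition _ :=
  GRing.isZmodClosed.Build V (submodule_pred Ksub) submodule_predB.

Local Notation Q :=
  (Quotient.quot (GRing.ZmodClosed.clone V (submodule_pred Ksub) _)).

Lemma quotient_pi_eq (x y : V) : \pi_Q x = \pi_Q y <-> K (x - y).
Proof.
split; first by move/eqmodP; rewrite /= /Quotient.equiv => /asboolP.
by move=> Kxy; apply/eqmodP; rewrite /= /Quotient.equiv; apply/asboolP.
Qed.

Definition quotient_scale (a : R) (q : Q) : Q := \pi_Q (a *: repr q).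

Lemma quotient_scale_pi a x : quotient_scale a (\pi_Q x) = \pi_Q (a *: x).
Proof.
apply/quotient_pi_eq; rewrite -scalerBr -[_ *: _]addr0.
have [K0 Kl] := Ksub; apply: (Kl) => //; apply/quotient_pi_eq.
exact: reprK.
Qed.

Lemma quotient_piW (P : Q -> Prop) : (forall x, P (\pi_Q x)) -> forall q, P q.
Proof. by move=> Ppi q; rewrite -[q]reprK. Qed.

Lemma quotient_scaleA a b q :
  quotient_scale a (quotient_scale b q) = quotient_scale (a * b) q.
Proof.
by move: q; apply: quotient_piW => x; rewrite !quotient_scale_pi scalerA.
Qed.

Lemma quotient_scale1 : left_id 1 quotient_scale.
Proof. by apply: quotient_piW => x; rewrite quotient_scale_pi scale1r. Qed.

Lemma quotient_scaleDr : right_distributive quotient_scale +%R.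
Proof.
move=> a; apply: quotient_piW => x; apply: quotient_piW => y.
by rewrite -raddfD !quotient_scale_pi -raddfD scalerDr.
Qed.

Lemma quotient_scaleDl q : {morph quotient_scale^~ q : a b / a + b}.
Proof.
move: q; apply: quotient_piW => x a b /=.
by rewrite !quotient_scale_pi -raddfD scalerDl.
Qed.

HB.instance Definition _ := GRing.Zmodule_isLmodule.Build R Q
  quotient_scaleA quotient_scale1 quotient_scaleDr quotient_scaleDl.

Lemma quotient_module_exists :
  exists (M : lmodType R) (p : {linear V -> M}),
    (forall q, exists x, p x = q) /\ (forall x, p x = 0 <-> K x).
Proof.
have pl : linear (\pi_Q : V -> Q).
  by move=> a x y; rewrite raddfD /= -quotient_scale_pi.
exists Q, (linear_map pl); split=> [q|x]; first by exists (repr q); apply: reprK.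
rewrite -{2}[x]subr0 -quotient_pi_eq raddf0; split; exact.
Qed.

End QuotientModule.

Lemma linear_factor U V W (p : {linear U -> V}) (f : {linear U -> W}) :
  (forall v, exists u, p u = v) -> (forall u, p u = 0 -> f u = 0) ->
  exists g : {linear V -> W}, forall u, g (p u) = f u.
Proof.
move=> psurj pf.
have [|||g gP] :=
  @linear_of_graph V W (fun v w => exists u, p u = v /\ f u = w).
- by move=> v; have [u <-] := psurj v; exists (f u), u.
- move=> a _ _ _ _ [u [<- <-]] [u' [<- <-]].
  by exists (a *: u + u'); rewrite !linearP.
- by move=> _ [u [pu <-]]; apply: pf.
exists g => u; have [u' [e <-]] := gP (p u).
by apply/eqP; rewrite -subr_eq0 -linearB; apply/eqP/pf; rewrite linearB e subrr.
Qed.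

End LinearConstructions.

(** * Perfect rings and principal ideals *)

Section TensorSpan.
Variables (R : comNzRingType) (U V T : lmodType R).
Variables (t : {bilinear U -> V -> T}) (tP : is_tensor_product t).

(** The quotient map by [S] and the zero map both factor the zero bilinear map,
    so the uniqueness clause of the universal property identifies them. *)
Lemma tensor_product_span (S : set T) :
  submodule S -> (forall u v, S (t u v)) -> forall x, S x.
Proof.
move=> Ssub St x; have [W [q [_ qS]]] := quotient_module_exists Ssub.
have bl : bilinear_for *:%R *:%R (fun (u : U) (v : V) => 0 : W).
  by split=> z a u v /=; rewrite scaler0 addr0.
have zl : linear (fun _ : T => 0 : W).
  by move=> a u v; rewrite scaler0 addr0.
have [h [_ huniq]] := tP (bilinear_map bl).
have qh : q =1 h by apply: huniq => u v; apply/qS.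
have zh : linear_map zl =1 h by apply: huniq.
by apply/qS; rewrite qh -zh.
Qed.

End TensorSpan.

Section BassModule.
Variables (C : comNzRingType) (a : nat -> C).

Definition seg n k := \prod_(n <= i < k) a i.

Lemma seg_cat n m k : (n <= m)%N -> (m <= k)%N -> seg n k = seg n m * seg m k.
Proof. by move=> nm mk; rewrite /seg (big_cat_nat nm mk). Qed.

(** [{poly C}] serves as the free module on the basis ['X^n], whose image in
    the colimit of [C -> C -> ...] is the unit of the [n]-th copy; [stage k]
    reads a combination of these units in the [k]-th copy. *)
Definition stage k (p : {poly C}) : C := \sum_(i < k) p`_i * seg i k.

Lemma stageP k : scalar (stage k).
Proof.
move=> c p q; rewrite /stage mulr_sumr -big_split /=.
by apply: eq_bigr => i _; rewrite coefD coefZ mulrDl mulrA.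
Qed.

Lemma stageXn n k : (n < k)%N -> stage k 'X^n = seg n k.
Proof.
move=> nk; rewrite /stage (bigD1 (Ordinal nk)) //= coefXn eqxx mul1r.
rewrite big1 ?addr0 // => i; rewrite coefXn -val_eqE /= => /negPf ->.
by rewrite mul0r.
Qed.

Lemma stage_shift (p : {poly C}) k l : (size p <= k)%N -> (k <= l)%N ->
  stage l p = stage k p * seg k l.
Proof.
move=> pk kl; rewrite /stage mulr_suml -(subnKC kl) big_split_ord /=.
rewrite [X in _ + X]big1 ?addr0 => [|i _].
  apply: eq_bigr => i _; rewrite -mulrA -seg_cat ?(ltnW (ltn_ord i)) //.
  exact: leq_addr.
by rewrite nth_default ?mul0r // (leq_trans pk) ?leq_addr.
Qed.

Definition eventually_zero (V : lmodType C) : set (nat -> V) :=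
  fun s => exists n, forall k, (n <= k)%N -> s k = 0.

Lemma eventually_zero_submodule V : submodule (@eventually_zero V).
Proof.
split; first by exists 0%N.
move=> c x y [n xn] [m ym]; exists (maxn n m) => k; rewrite geq_max => /andP[nk mk].
have -> : (c *: x + y) k = c *: x k + y k by [].
by rewrite xn ?ym ?scaler0 ?addr0.
Qed.

Definition stage_zero : set {poly C} :=
  fun p => exists n, forall k, (n <= k)%N -> stage k p = 0.

Lemma stage_zero_submodule : submodule stage_zero.
Proof.
split; first by exists 0%N => k _; rewrite /stage big1 // => i _; rewrite coef0 mul0r.
move=> c x y [n xn] [m ym]; exists (maxn n m) => k; rewrite geq_max => /andP[nk mk].
by rewrite stageP xn ?ym ?mulr0 ?addr0.
Qed.

Section Colimit.
Variables (M : lmodType C) (p : {linear {poly C} -> M}).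
Hypotheses (psurj : forall m, exists x, p x = m)
           (pker : forall x, p x = 0 <-> stage_zero x).

Lemma colim_eq x y : p x = p y <-> stage_zero (x - y).
Proof.
by rewrite -pker linearB; split=> [->|/eqP]; rewrite ?subrr // subr_eq0 => /eqP.
Qed.

Lemma stageB k x y : stage k (x - y) = stage k x - stage k y.
Proof. by rewrite addrC -scaleN1r stageP mulN1r addrC. Qed.

Lemma stageZ k c x : stage k (c *: x) = c * stage k x.
Proof.
have s0 : stage k 0 = 0 by rewrite /stage big1 // => i _; rewrite coef0 mul0r.
by rewrite -[c *: x]addr0 stageP s0 addr0.
Qed.

Lemma colim_pi (x : {poly C}) k : (size x <= k)%N -> p x = stage k x *: p 'X^k.
Proof.
move=> xk; rewrite -linearZ; apply/colim_eq; exists k.+1 => l kl.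
by rewrite stageB stageZ stageXn // (stage_shift xk (ltnW kl)) subrr.
Qed.

Lemma colim_shift n k : (n <= k)%N -> p 'X^n = seg n k *: p 'X^k.
Proof.
move=> nk; rewrite -linearZ; apply/colim_eq; exists k.+1 => l kl.
rewrite stageB stageZ !stageXn ?(leq_ltn_trans nk kl) //.
by rewrite -seg_cat ?subrr // ltnW.
Qed.

(** A tensor with the colimit is a single [u (x) 'X^n]; it vanishes only if
    [u] is killed by some product [a_n ... a_(k-1)], a condition which is
    reflected by injective maps. *)
Lemma colim_flat : flat M.
Proof.
move=> N N' f T T' t t' g tP tP' gP finj.
have tN u : t 0 u = 0 by rewrite linear0l.
have pure (x : T) : exists u n, x = t u (p 'X^n).
  move: x; apply: (tensor_product_span tP (S := fun x => exists u n, x = t u (p 'X^n))).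
    split; first by exists 0, 0%N.
    move=> c _ _ [u [n ->]] [v [m ->]]; set k := maxn n m.
    rewrite (@colim_shift n k) ?leq_maxl // (@colim_shift m k) ?leq_maxr //.
    exists (c *: (seg n k *: u) + seg m k *: v), k.
    by rewrite !linearZr_LR /= linearDl !linearZl_LR.
  move=> u m; have [x <-] := psurj m.
  exists (stage (size x) x *: u), (size x).
  by rewrite linearZl_LR (colim_pi (leqnn _)) linearZr_LR.
(* Sequences up to eventual equality contain the colimit of the copies of
   [N'] and detect whether the image of [y (x) 'X^n] is zero. *)
have [L [q [_ qker]]] := quotient_module_exists (eventually_zero_submodule N').
pose germ (y : N') x : nat -> N' := fun k => stage k x *: y.
have [r rP] := choice psurj.
have germ_eq y x m : p x = m -> q (germ y (r m)) = q (germ y x).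
  move=> pxm; apply/eqP; rewrite -subr_eq0 -linearB; apply/eqP/qker.
  have /colim_eq[n xn] : p (r m) = p x by rewrite rP.
  exists n => k nk.
  have -> : (germ y (r m) - germ y x) k = stage k (r m) *: y - stage k x *: y by [].
  by rewrite -scalerBl -stageB xn ?scale0r.
have bl : bilinear_for *:%R *:%R (fun (y : N') m => q (germ y (r m))).
  split=> [m c y y'|y c m m'] /=.
    rewrite -linearP; congr (q _); apply/funext => k.
    have -> : (c *: germ y (r m) + germ y' (r m)) k =
      c *: (stage k (r m) *: y) + stage k (r m) *: y' by [].
    by rewrite /germ scalerDr !scalerA mulrC.
  rewrite (germ_eq _ (c *: r m + r m')) ?linearP ?rP //.
  rewrite -linearP; congr (q _); apply/funext => k.
  have -> : (c *: germ y (r m) + germ y (r m')) k =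
    c *: (stage k (r m) *: y) + stage k (r m') *: y by [].
  by rewrite /germ stageP scalerDl scalerA.
have [h [hP _]] := tP' L (bilinear_map bl).
have gker x : g x = 0 -> x = 0.
  have [u [n ->]] := pure x; rewrite gP => t'0.
  have := hP (f u) (p 'X^n); rewrite t'0 linear0 => /esym.
  rewrite [LHS](germ_eq _ 'X^n) // => /qker[l lP].
  pose k := maxn l n.+1.
  have := lP k (leq_maxl _ _); rewrite /germ stageXn ?leq_maxr // -linearZ.
  have nk : (n <= k)%N by rewrite leq_max leqnSn orbT.
  rewrite -[RHS](linear0 f) => /finj su0.
  by rewrite (colim_shift nk) linearZr_LR -linearZl_LR su0 linear0l.
move=> x y gxy; apply/eqP; rewrite -subr_eq0; apply/eqP/gker.
by rewrite linearB gxy subrr.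
Qed.

(** A section of [p] sends the unit of the [0]-th copy to a polynomial all of
    whose coefficients are divisible by every partial product, and comparing it
    with ['X^0] at a late stage writes a partial product as a combination of
    these coefficients. *)
Lemma colim_split_stable :
  projective M -> exists n, forall m, exists c, seg 0 n = seg 0 m * c.
Proof.
move=> Mproj; have il : linear (@id M) by [].
have [h hP] := Mproj _ _ p (linear_map il) psurj.
have hX m : h (p 'X^0) = seg 0 m *: h (p 'X^m).
  by rewrite -linearZ -colim_shift.
have /colim_eq[n nP] := hP (p 'X^0).
exists n.+1 => m; exists (stage n.+1 (h (p 'X^m))).
have /eqP := nP n.+1 (leqnSn n).
by rewrite stageB (hX m) stageZ stageXn // subr_eq0 => /eqP ->.
Qed.

End Colimit.

Lemma perfect_dcc : perfect C ->
  exists n c, \prod_(i < n) a i = \prod_(i < n.+1) a i * c.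
Proof.
move=> Cperf; have [M [p [ps pk]]] := quotient_module_exists stage_zero_submodule.
have [n nP] := colim_split_stable ps pk (Cperf _ (colim_flat ps pk)).
have [c nc] := nP n.+1.
by exists n, c; move: nc; rewrite /seg !big_mkord.
Qed.

End BassModule.

(** * The equational criterion for flatness *)

Section EquationalFlatness.
Variables (C : comNzRingType) (M : lmodType C) (K : finType) (a : K -> C).

Definition trivial_relation (x : K -> M) : Prop :=
  exists (L : finType) (d : K -> L -> C) (y : L -> M),
    (forall i, x i = \sum_l d i l *: y l) /\
    (forall l, \sum_i a i * d i l = 0).

Lemma fct_lin (V : lmodType C) c (x y : K -> V) i :
  (c *: x + y) i = c *: x i + y i.
Proof. by []. Qed.

Lemma trivial_relation_submodule : submodule trivial_relation.
Proof.
split.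
  exists 'I_0, (fun _ _ => 0), (fun _ => 0); split=> [i|[]//].
  by rewrite big_ord0.
move=> c x x' [L [d [y [dx ad]]]] [L' [d' [y' [dx' ad']]]].
exists (L + L')%type,
  (fun i l => match l with inl l => c * d i l | inr l => d' i l end),
  (fun l => match l with inl l => y l | inr l => y' l end); split=> [i|[l|l]].
- rewrite fct_lin dx dx' big_sumType /= scaler_sumr; congr (_ + _).
  by apply: eq_bigr => l _; rewrite scalerA.
- under eq_bigr do rewrite mulrCA.
  by rewrite -mulr_sumr ad mulr0.
- exact: ad'.
Qed.

Definition dotp (u : K -> C^o) : C^o := \sum_i a i * u i.

Lemma dotp_linear : linear dotp.
Proof.
move=> c u v; rewrite /dotp scaler_sumr -big_split /=; apply: eq_bigr => i _.
by rewrite fct_lin mulrDr /GRing.scale /= mulrCA.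
Qed.

Lemma dotp_ker_submodule : submodule (fun u => dotp u = 0).
Proof.
split; first by rewrite /dotp big1 // => i _; rewrite mulr0.
by move=> c u v u0 v0; rewrite dotp_linear u0 v0 scaler0 addr0.
Qed.

Definition unit_vec (i : K) : K -> C^o := fun j => (i == j)%:R.

Lemma fct_sum (V : lmodType C) (I : finType) (F : I -> K -> V) j :
  (\sum_i F i) j = \sum_i F i j.
Proof. by rewrite fct_sumE. Qed.

Lemma unit_vecE u : u = \sum_i u i *: unit_vec i.
Proof.
apply/funext => j; rewrite fct_sum (bigD1 j) //= big1 ?addr0 => [|i /negPf ij].
  by rewrite [RHS]/(u j * (j == j)%:R) eqxx; apply/esym/mulr1.
by rewrite [LHS]/(u i * (i == j)%:R) ij; apply: mulr0.
Qed.

(** With [N := C^K / ker (a .)], which [a] embeds in [C], the tensor product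
    [N (x) M] is [M^K] modulo the trivial relations.  Flatness makes the map
    [x |-> \sum_i a i *: x i] from it to [C (x) M = M] injective. *)
Lemma flat_trivial_relation x :
  flat M -> \sum_i a i *: x i = 0 -> trivial_relation x.
Proof.
move=> Mflat ax0.
have [N [p [psurj pker]]] := quotient_module_exists dotp_ker_submodule.
have [T [q [qsurj qker]]] := quotient_module_exists trivial_relation_submodule.
have [|f fP] := linear_factor (f := linear_map dotp_linear) psurj.
  by move=> u /pker.
have finj : injective f.
  move=> n n'; have [u <-] := psurj n; have [u' <-] := psurj n'.
  rewrite !fP /= => /eqP; rewrite -subr_eq0 => /eqP uu'.
  apply/eqP; rewrite -subr_eq0 -linearB; apply/eqP/pker.
  by rewrite -scaleN1r addrC dotp_linear scaleN1r addrC.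
have [r rP] := choice psurj.
pose pure n m : K -> M := fun i => r n i *: m.
have pure_eq n u m : p u = n -> q (pure n m) = q (fun i => u i *: m).
  move=> pu; apply/eqP; rewrite -subr_eq0 -linearB; apply/eqP/qker.
  have /pker : p (r n - u) = 0 by rewrite linearB rP pu subrr.
  move=> u0; exists unit, (fun i _ => r n i - u i), (fun _ => m).
  split=> [i|_]; last by rewrite -[RHS]u0.
  by rewrite (big_pred1 tt) ?scalerBl // => -[].
have bl : bilinear_for *:%R *:%R (fun n m => q (pure n m)).
  split=> [m c n n'|n c m m'] /=.
    rewrite (pure_eq _ (c *: r n + r n')) ?linearP ?rP // -linearP.
    by congr (q _); apply/funext => i; rewrite !fct_lin scalerDl scalerA.
  rewrite -linearP; congr (q _); apply/funext => i.
  by rewrite fct_lin /pure scalerDr !scalerA mulrC.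
pose t := bilinear_map bl.
have scl : bilinear_for *:%R *:%R (fun (c : C^o) (m : M) => c *: m).
  split=> [m c u v|c d m m'] /=; first by rewrite scalerDl scalerA.
  by rewrite scalerDr !scalerA mulrC.
have tP' : is_tensor_product (bilinear_map scl).
  move=> W b.
  have hl : linear (b (1 : C^o)) by move=> c m m'; rewrite linearPr.
  exists (linear_map hl); split=> [c m|h hP m] /=.
    by rewrite linearZr_LR -linearZl_LR; congr (b _ _); rewrite /GRing.scale /= mulr1.
  by rewrite -hP /= scale1r.
have qsum w : q w = \sum_i t (p (unit_vec i)) (w i).
  rewrite -[LHS]/(q w) /t /=.
  under eq_bigr => i _ do rewrite (pure_eq _ (unit_vec i)) //.
  rewrite -linear_sum; congr (q _); apply/funext => j.
  rewrite fct_sum (bigD1 j) //= big1 ?addr0 => [|i /negPf ij].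
    by rewrite /unit_vec eqxx scale1r.
  by rewrite /unit_vec ij scale0r.
have expand (W : lmodType C) (b : {bilinear N -> M -> W}) (u : K -> C^o) m :
    b (p u) m = \sum_i b (p (unit_vec i)) (u i *: m).
  rewrite {1}(unit_vecE u) linear_sum linear_sumlz; apply: eq_bigr => i _.
  by rewrite linearZ linearZl_LR linearZr_LR.
have tP : is_tensor_product t.
  move=> W b.
  have hl : linear (fun w : K -> M => \sum_i b (p (unit_vec i)) (w i)).
    move=> c w w'; rewrite scaler_sumr -big_split /=; apply: eq_bigr => i _.
    by rewrite fct_lin linearPr.
  have [|h hP] := linear_factor (f := linear_map hl) qsurj.
    move=> w /qker[L [d [y [dw ad]]]] /=.
    under eq_bigr => i _ do rewrite dw linear_sumr /=.
    rewrite exchange_big /= big1 // => l _.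
    rewrite -(expand _ b (d^~ l)).
    have /pker -> : dotp (d^~ l) = 0 by exact: ad.
    by rewrite linear0l.
  exists h; split=> [n m|h' h'P x'].
    by rewrite -[t n m]/(q (pure n m)) hP /= -(expand _ b (r n)) rP.
  have [w <-] := qsurj x'; rewrite hP /= qsum linear_sum.
  by apply: eq_bigr => i _; rewrite h'P.
have al : linear (fun w : K -> M => \sum_i a i *: w i).
  move=> c w w'; rewrite scaler_sumr -big_split /=; apply: eq_bigr => i _.
  by rewrite fct_lin scalerDr !scalerA mulrC.
have [|g gP] := linear_factor (f := linear_map al) qsurj.
  move=> w /qker[L [d [y [dw ad]]]] /=.
  under eq_bigr => i _ do rewrite dw scaler_sumr.
  rewrite exchange_big /= big1 // => l _.
  under eq_bigr do rewrite scalerA.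
  by rewrite -scaler_suml ad scale0r.
have gt n m : g (t n m) = bilinear_map scl (f n) m.
  rewrite -[t n m]/(q (pure n m)) gP /= -{2}(rP n) fP /= /dotp scaler_suml.
  by apply: eq_bigr => i _; rewrite scalerA.
have ginj := Mflat _ _ f _ _ t _ g tP tP' gt finj.
by apply/qker/ginj; rewrite gP /= ax0 linear0.
Qed.

End EquationalFlatness.

(** * Nilpotent elements and local idempotents *)

Definition nil_elt (A : comNzRingType) (x : A) : Prop := exists n, x ^+ n = 0.

Section Nilpotent.
Variable A : comNzRingType.
Implicit Types x y : A.

Lemma nilp0 : nil_elt (0 : A). Proof. by exists 1%N; rewrite expr1. Qed.

Lemma nilpMr x y : nil_elt x -> nil_elt (x * y).
Proof. by case=> n xn; exists n; rewrite exprMn xn mul0r. Qed.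

Lemma nilpMl x y : nil_elt y -> nil_elt (x * y).
Proof. by rewrite mulrC; apply: nilpMr. Qed.

Lemma nilpD x y : nil_elt x -> nil_elt y -> nil_elt (x + y).
Proof.
case=> n xn [m ym]; exists (n + m)%N; rewrite exprDn big1 // => i _.
have [mi|im] := leqP m i.
  by rewrite -(subnKC mi) exprD ym mul0r mulr0 mul0rn.
have -> : (n + m - i = n + (m - i))%N by rewrite addnBA // ltnW.
by rewrite exprD xn !mul0r mul0rn.
Qed.

Lemma nilp_sum (I : Type) (r : seq I) (P : pred I) (F : I -> A) :
  (forall i, P i -> nil_elt (F i)) -> nil_elt (\sum_(i <- r | P i) F i).
Proof. by move=> Fn; elim/big_rec: _ => [|i x /Fn]; [exact: nilp0|exact: nilpD]. Qed.

Lemma nilp_unit x : nil_elt x -> exists y, (1 - x) * y = 1.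
Proof.
case=> n xn; exists (\sum_(i < n) x ^+ i).
by rewrite -[1 - x]opprB mulNr -subrX1 xn sub0r opprK.
Qed.

Lemma nilp_idem x : x * x = x -> nil_elt x -> x = 0.
Proof.
move=> xx [n xn]; have xX k : x ^+ k.+1 = x.
  by elim: k => [|k IHk]; rewrite ?expr1 // exprS IHk.
by rewrite -(xX n) exprS xn mulr0.
Qed.

(** [e A] is a local ring with nil maximal ideal, or zero. *)
Definition local_idem (e : A) : Prop :=
  e * e = e /\ forall x, nil_elt (e * x) \/ exists y, e * x * y = e.

(** The nilradical of [e A] is T-nilpotent. *)
Definition tnilp (e : A) : Prop :=
  forall a : nat -> A, (forall i, nil_elt (e * a i)) ->
    exists n, e * \prod_(i < n) a i = 0.

End Nilpotent.

(** * Flat modules over a local ring with T-nilpotent maximal ideal are free *)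

Section LocalFlat.
Variables (C : comNzRingType) (e : C) (eloc : local_idem e) (etn : tnilp e).
Variable (M : lmodType C).

Let ee : e * e = e. Proof. by case: eloc. Qed.

(** [m M], for the maximal ideal [m] of [e C]. *)
Definition nilM (x : M) : Prop :=
  exists (K : finType) (u : K -> C) (y : K -> M),
    (forall i, nil_elt (e * u i)) /\ x = \sum_i u i *: y i.

Lemma nilM_submodule : submodule nilM.
Proof.
split; first by exists 'I_0, (fun _ => 0), (fun _ => 0); rewrite big_ord0; split=> [[]|].
move=> c _ _ [K [u [y [un ->]]]] [L [v [z [vn ->]]]].
exists (K + L)%type,
  (fun i => match i with inl i => c * u i | inr i => v i end),
  (fun i => match i with inl i => y i | inr i => z i end); split.
  by case=> i //; rewrite mulrCA; apply/nilpMl/un.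
rewrite big_sumType /= scaler_sumr; congr (_ + _).
by apply: eq_bigr => i _; rewrite scalerA.
Qed.

Lemma nilM1 u x : nil_elt (e * u) -> nilM (u *: x).
Proof.
move=> un; exists unit, (fun _ => u), (fun _ => x); split=> //.
by rewrite (big_pred1 tt) // => -[].
Qed.

Definition indep n (v : 'I_n -> M) : Prop :=
  forall c : 'I_n -> C, nilM (\sum_i c i *: v i) -> forall i, nil_elt (e * c i).

Lemma nilMD x y : nilM x -> nilM y -> nilM (x + y).
Proof. by move=> xn yn; rewrite -[x]scale1r; apply nilM_submodule. Qed.

Lemma nilMZ c x : nilM x -> nilM (c *: x).
Proof. by move=> xn; rewrite -[c *: x]addr0; apply nilM_submodule => //; apply nilM_submodule. Qed.

(** A relation is trivial by flatness, hence expresses some coefficient through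
    the others unless all its vectors lie in [m M]; eliminating that vector
    keeps the remaining ones independent modulo [m M]. *)
Lemma flat_indep n (v : 'I_n -> M) :
  flat M -> (forall i, e *: v i = v i) -> indep v ->
  forall c : 'I_n -> C, \sum_i c i *: v i = 0 -> forall i, e * c i = 0.
Proof.
move=> Mflat; elim: n v => [|n IHn] v ev vind c cv0; first by case.
have [L [d [y [dv cd]]]] := flat_trivial_relation Mflat cv0.
have [dn|[l [u du]]] : (forall l, nil_elt (e * d ord0 l)) \/
    exists l u, e * d ord0 l * u = e.
- have [?|/existsNP[l dn]] := pselect (forall l, nil_elt (e * d ord0 l)); first by left.
  by have [//|[u du]] := eloc.2 (d ord0 l); right; exists l, u.
- suff e0 : e = 0 by move=> i; rewrite e0 mul0r.
  apply: (nilp_idem ee).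
  have := vind (fun i => (i == ord0)%:R) _ ord0; rewrite /= mulr1; apply.
  rewrite (bigD1 ord0) //= scale1r big1 ?addr0 => [|i /negPf ->].
    by rewrite dv; exists L, (d ord0), y.
  by rewrite scale0r.
pose t (i : 'I_n) := - (e * u * d (lift ord0 i) l).
have ec0 : e * c ord0 = \sum_i c (lift ord0 i) * t i.
  have -> : e * c ord0 = e * u * (c ord0 * d ord0 l) by rewrite -{1}du; ring.
  have /eqP := cd l; rewrite big_ord_recl addr_eq0 => /eqP ->.
  rewrite mulrN mulr_sumr -sumrN; apply: eq_bigr => i _.
  by rewrite /t mulrN mulrCA.
pose v' i := v (lift ord0 i) + t i *: v ord0.
have sum_v' (b : 'I_n -> C) : \sum_i b i *: v' i =
    (\sum_i b i * t i) *: v ord0 + \sum_i b i *: v (lift ord0 i).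
  rewrite scaler_suml -big_split /=; apply: eq_bigr => i _.
  by rewrite scalerDr scalerA addrC.
have ev' i : e *: v' i = v' i.
  by rewrite scalerDr ev scalerA mulrC -scalerA ev.
have vind' : indep v'.
  move=> b; rewrite sum_v' => bn i.
  pose b' j := if unlift ord0 j is Some k then b k else \sum_i b i * t i.
  have b'S k : b' (lift ord0 k) = b k by rewrite /b' liftK.
  rewrite -b'S; apply: vind; rewrite big_ord_recl {1}/b' unlift_none.
  by under [X in _ + X]eq_bigr do rewrite b'S.
have ct i : e * c (lift ord0 i) = 0.
  apply: (IHn v' ev' vind' (fun i => c (lift ord0 i))).
  by rewrite sum_v' -ec0 mulrC -scalerA ev -[RHS]cv0 big_ord_recl.
move=> i; have [j ->|->] := unliftP ord0 i; first exact: ct.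
rewrite -ee -mulrA ec0 mulr_sumr big1 // => j _.
by rewrite mulrA ct mul0r.
Qed.

Definition spanned (B : set M) (x : M) : Prop :=
  exists (K : finType) (c : K -> C) (v : K -> M),
    (forall i, B (v i)) /\ x = \sum_i c i *: v i.

Lemma spanned_submodule B : submodule (spanned B).
Proof.
split; first by exists 'I_0, (fun _ => 0), (fun _ => 0); rewrite big_ord0; split=> [[]|].
move=> c _ _ [K [u [y [un ->]]]] [L [v [z [vn ->]]]].
exists (K + L)%type,
  (fun i => match i with inl i => c * u i | inr i => v i end),
  (fun i => match i with inl i => y i | inr i => z i end); split; first by case.
rewrite big_sumType /= scaler_sumr; congr (_ + _).
by apply: eq_bigr => i _; rewrite scalerA.
Qed.

Lemma spannedD B x y : spanned B x -> spanned B y -> spanned B (x + y).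
Proof. by move=> xn yn; rewrite -[x]scale1r; apply spanned_submodule. Qed.

Lemma spannedZ B c x : spanned B x -> spanned B (c *: x).
Proof.
move=> xn; rewrite -[c *: x]addr0; apply (spanned_submodule B) => //.
exact: (spanned_submodule B).1.
Qed.

Lemma spanned_mem (B : set M) x : B x -> spanned B x.
Proof.
move=> Bx; exists unit, (fun _ => 1), (fun _ => x); split=> //.
by rewrite (big_pred1 tt) ?scale1r // => -[].
Qed.

Lemma spanned_sum B (K : finType) (P : pred K) (x : K -> M) :
  (forall i, P i -> spanned B (x i)) -> spanned B (\sum_(i | P i) x i).
Proof.
move=> Bx; elim/big_rec: _ => [|i y /Bx]; last exact: spannedD.
exact: (spanned_submodule B).1.
Qed.

Definition indep_set (B : set M) : Prop :=
  (forall b, B b -> e *: b = b) /\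
  forall n (v : 'I_n -> M), injective v -> (forall i, B (v i)) -> indep v.

Lemma chain_family (F : set (set M)) n (v : 'I_n -> M) :
  total_on F subset -> (forall i, (\bigcup_(X in F) X) (v i)) ->
  n = 0%N \/ exists2 X, F X & forall i, X (v i).
Proof.
move=> Ftot; elim: n v => [|n IHn] v Fv; first by left.
right; have [X0 FX0 X0v] := Fv ord0.
have [n0|[X FX Xv]] := IHn _ (fun i => Fv (lift ord0 i)).
  exists X0 => // i; suff -> : i = ord0 by [].
  by apply: val_inj; move: i => [[|i] //=]; rewrite n0.
have [sub|sub] := Ftot _ _ FX0 FX; [exists X | exists X0] => // i;
  have [j ->|->] := unliftP ord0 i => //; exact: sub.
Qed.

(** Zorn's lemma applies because independence is tested on finite subfamilies. *)
Lemma maximal_indep_set :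
  exists2 B, indep_set B & forall B', B `<` B' -> ~ indep_set B'.
Proof.
have [F sub Ftot|B [Bi Bmax]] := @Zorn_bigcup M indep_set; last by exists B.
split=> [b [X FX Xb]|n v vinj Fv]; first exact: (sub _ FX).1.
have [n0|[X FX Xv]] := chain_family Ftot Fv.
  by move=> c _ i; have := ltn_ord i; rewrite {2}n0.
exact: (sub _ FX).2.
Qed.

Lemma maximal_indep_span B : indep_set B ->
  (forall B', B `<` B' -> ~ indep_set B') ->
  forall x, e *: x = x -> exists s, spanned B s /\ nilM (x - s).
Proof.
move=> [Be Bi] Bmax x ex; have [Bx|nBx] := pselect (B x).
  exists x; split; first exact: spanned_mem.
  by rewrite subrr; apply nilM_submodule.
have /Bmax : B `<` (B `|` [set x]).
  split; first by move=> y; left.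
  by move=> sub; apply/nBx/sub; right.
apply: contra_notP => nx; split=> [b [/Be //|-> //]|n v vinj Bxv].
have [/existsNP[j /contrapT xj]|vx] := pselect (~ (forall i, v i <> x)); last first.
  apply: Bi => // i; case: (Bxv i) => // vix.
  by case: vx => /(_ i).
case: n v vinj Bxv j xj => [|n] v vinj Bxv j xj; first by case: (j).
pose w i := v (lift j i).
have winj : injective w by move=> i k /vinj /lift_inj.
have Bw i : B (w i).
  case: (Bxv (lift j i)) => // wx.
  by have /vinj /esym/eqP := etrans wx (esym xj); rewrite (negPf (neq_lift j i)).
move=> c; rewrite (bigD1_ord j) //= xj => cn.
have cj : nil_elt (e * c j).
  apply: contrapT => ncj; have [//|[u du]] := eloc.2 (c j).
  apply: nx; exists (- (u * e) *: \sum_i c (lift j i) *: w i); split.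
    by apply: spannedZ; apply: spanned_sum => i _; apply/spannedZ/spanned_mem.
  rewrite scaleNr opprK; have <- : (u * e * c j) *: x = x.
    by rewrite -[RHS]ex -[in RHS]du; congr (_ *: _); ring.
  by rewrite -scalerA -scalerDr; apply: nilMZ.
have wn : nilM (\sum_i c (lift j i) *: w i).
  have := nilMD cn (nilMZ (-1) (nilM1 x cj)).
  by rewrite scaleN1r addrAC subrr add0r.
have cw := Bi _ _ winj Bw _ wn.
by move=> i; have [k ->|->] := unliftP j i; first exact: cw.
Qed.

(** Nakayama's lemma for a T-nilpotent ideal: a vector outside the span would
    produce vectors [x_k] and elements [u_k] of [m] such that no
    [u_0 ... u_(k-1) x_k] lies in the span. *)
Lemma indep_set_span B : indep_set B ->
  (forall x, e *: x = x -> exists s, spanned B s /\ nilM (x - s)) ->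
  forall x, spanned B (e *: x).
Proof.
move=> [Be Bi] Bs x0; apply: contrapT => nx0.
have step (s : C * M) : exists r : C * M, ~ spanned B (s.1 *: (e *: s.2)) ->
    nil_elt (e * r.1) /\ ~ spanned B ((s.1 * r.1) *: (e *: r.2)).
  have [sn|/contrapT sn] := pselect (~ spanned B (s.1 *: (e *: s.2))); last by exists (0, 0).
  apply: contrapT => /forallNP nr; apply: sn.
  have [|t [Bt [K [u [y [un st]]]]]] := Bs (e *: s.2).
    by rewrite scalerA ee.
  have -> : s.1 *: (e *: s.2) =
      s.1 *: (e *: t) + \sum_i (s.1 * u i) *: (e *: y i).
    rewrite -{1}ee -scalerA -[e *: s.2](subrK t) st scalerDr addrC scalerDr.
    rewrite !scaler_sumr; congr (_ + _); apply: eq_bigr => i _.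
    by rewrite !scalerA -!mulrA [u i * e]mulrC.
  apply: spannedD; first by do 2!apply: spannedZ.
  apply: spanned_sum => i _; apply: contrapT => ns.
  by apply: (nr (u i, y i)) => _; split; [exact: un | exact: ns].
have [f fP] := choice step.
pose st k := iter k (fun s => (s.1 * (f s).1, (f s).2)) (1, x0).
have stN k : ~ spanned B ((st k).1 *: (e *: (st k).2)).
  elim: k => [|k IHk]; first by rewrite scale1r.
  by rewrite /st iterS; exact: (fP _ _).2.
have [|n en] := etn (a := fun k => (f (st k)).1).
  by move=> k; exact: (fP _ (stN k)).1.
have st1 k : (st k).1 = \prod_(i < k) (f (st i)).1.
  by elim: k => [|k IHk]; rewrite ?big_ord0 // big_ord_recr -IHk.
apply: (stN n); rewrite scalerA mulrC st1 en scale0r.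
exact: (spanned_submodule B).1.
Qed.

(** The family [v] may repeat vectors; grouping equal ones reduces to
    [flat_indep]. *)
Lemma indep_set_relation B (K : finType) (c : K -> C) (v : K -> M)
    (W : lmodType C) (l : M -> W) :
  flat M -> indep_set B -> (forall i, B (v i)) -> \sum_i c i *: v i = 0 ->
  \sum_i (e * c i) *: l (v i) = 0.
Proof.
move=> Mflat [Be Bi] Bv cv0; pose s := undup (codom v).
have group (V : lmodType C) (d : K -> C) (g : M -> V) :
    \sum_i d i *: g (v i) =
    \sum_(j < size s) (\sum_(i | v i == tnth (in_tuple s) j) d i)
      *: g (tnth (in_tuple s) j).
  under [RHS]eq_bigr do rewrite scaler_suml.
  rewrite (exchange_big_dep predT) //=; apply: eq_bigr => i _.
  have vis : v i \in in_tuple s by rewrite mem_undup codom_f.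
  have [j vj] := tnthP _ _ vis.
  rewrite (big_pred1 j) -?vj // => k; rewrite vj eq_sym.
  by rewrite (inj_eq (@tuple_uniqP _ _ (in_tuple s) (undup_uniq _))).
have sB j : B (tnth (in_tuple s) j).
  have := mem_tnth j (in_tuple s); rewrite mem_undup => /codomP[i ->].
  exact: Bv.
pose t j := \sum_(i | v i == tnth (in_tuple s) j) c i.
have t0 : forall j, e * t j = 0.
  apply: (flat_indep (v := tnth (in_tuple s))) => // [j||].
  - exact/Be/sB.
  - by apply: Bi => //; apply/tuple_uniqP/undup_uniq.
  - by rewrite -[RHS]cv0 (group M c id).
rewrite group big1 // => j _.
by rewrite -mulr_sumr t0 scale0r.
Qed.

(** The part [e M] is free over [e C], so lifts may be chosen on a basis. *)
Lemma local_lift (N N' : lmodType C) (p : {linear N -> N'})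
    (f : {linear M -> N'}) :
  flat M -> (forall y, exists x, p x = y) ->
  exists h : {linear M -> N}, forall x, p (h x) = f (e *: x).
Proof.
move=> Mflat psurj; have [B Bi Bmax] := maximal_indep_set.
have Bspan := indep_set_span Bi (maximal_indep_span Bi Bmax).
have [l lP] := choice (fun b => psurj (f b)).
have [|||h hP] := @linear_of_graph _ M N (fun x y =>
  exists (K : finType) (c : K -> C) (v : K -> M),
    [/\ forall i, B (v i), e *: x = \sum_i c i *: v i
      & y = \sum_i (e * c i) *: l (v i)]).
- move=> x; have [K [c [v [Bv ex]]]] := Bspan x.
  by exists (\sum_i (e * c i) *: l (v i)), K, c, v.
- move=> a x _ x' _ [K [c [v [Bv ex ->]]]] [L [d [w [Bw ex' ->]]]].
  exists (K + L)%type,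
    (fun i => match i with inl i => a * c i | inr i => d i end),
    (fun i => match i with inl i => v i | inr i => w i end); split; first by case.
    rewrite big_sumType scalerDr scalerA mulrC -scalerA ex ex' /=.
    rewrite scaler_sumr; congr (_ + _); apply: eq_bigr => i _.
    by rewrite scalerA.
  rewrite big_sumType /= scaler_sumr; congr (_ + _); apply: eq_bigr => i _.
  by rewrite scalerA mulrCA.
- move=> y [K [c [v [Bv ex ->]]]]; apply: indep_set_relation Bi Bv _ => //.
  by rewrite -ex scaler0.
exists h => x; have [K [c [v [Bv ex ->]]]] := hP x.
rewrite -[in RHS]ee -scalerA ex scaler_sumr !linear_sum; apply: eq_bigr => i _.
by rewrite scalerA !linearZ lP.
Qed.

End LocalFlat.

(** For orthogonal members, a decomposition of [e C] as a finite product of local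
    rings with T-nilpotent maximal ideals. *)
Definition local_decomp (C : comNzRingType) (e : C) (s : seq C) : Prop :=
  \sum_(x <- s) x = e /\ forall x, x \in s -> local_idem x /\ tnilp x.

Lemma local_decomp_perfect (C : comNzRingType) (s : seq C) :
  local_decomp 1 s -> perfect C.
Proof.
move=> [s1 sloc] M Mflat N N' p f psurj.
suff [h hP] : exists h : {linear M -> N},
    forall x, p (h x) = f ((\sum_(e <- s) e) *: x).
  by exists h => x; rewrite hP s1 scale1r.
elim: s sloc {s1} => [|e s IHs] sloc.
  have zl : linear (fun _ : M => 0 : N) by move=> a u v; rewrite scaler0 addr0.
  by exists (linear_map zl) => x; rewrite big_nil scale0r !linear0.
have [|g gP] := IHs; first by move=> x xs; apply: sloc; rewrite inE xs orbT.
have [eloc etn] := sloc e (mem_head _ _).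
have [h hP] := local_lift eloc etn f Mflat psurj.
have hl : linear (fun x => h x + g x).
  by move=> a u v; rewrite !linearP scalerDr addrACA.
exists (linear_map hl) => x; rewrite /= linearD hP gP -linearD.
by rewrite big_cons scalerDl.
Qed.

(** * Chain conditions produce local decompositions *)

Section ChainCondition.
Variables (C : comNzRingType) (N : set C).
Hypotheses (NM : forall x y, N y -> N (x * y))
  (Ntn : forall a : nat -> C, (forall i, N (a i)) ->
     exists n, \prod_(i < n) a i = 0).

(** A weak descending chain condition for principal ideals of [e C], read
    modulo [N]. *)
Definition dcc_mod (e : C) : Prop := forall a : nat -> C, exists n c,
  N (e * (\prod_(i < n) a i - \prod_(i < n.+1) a i * c)).

Lemma dcc_mod_sub e f : dcc_mod e -> e * f = f -> dcc_mod f.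
Proof.
move=> De ef a; have [n [c nc]] := De a; exists n, c.
by rewrite -ef [e * f]mulrC -mulrA; apply: NM.
Qed.

Lemma N_nilp x : N x -> nil_elt x.
Proof.
move=> Nx; have [//|n xn] := Ntn (a := fun=> x).
by exists n; rewrite -xn prodr_const card_ord.
Qed.

(** For a nilpotent sequence the chain condition puts a partial product in [N];
    grouping the sequence in blocks whose products are in [N] reduces to the
    T-nilpotence of [N]. *)
Lemma dcc_mod_tnilp f : f * f = f -> dcc_mod f -> tnilp f.
Proof.
move=> ff Df.
have block (a : nat -> C) : (forall i, nil_elt (f * a i)) ->
    exists n, N (f * \prod_(i < n) a i).
  move=> an; have [n [c nc]] := Df a; exists n.
  have [y uy] := nilp_unit (nilpMr c (an n)).
  have -> : f * \prod_(i < n) a i =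
    y * (f * (\prod_(i < n) a i - \prod_(i < n.+1) a i * c)); last exact: NM.
  rewrite big_ord_recr /=; set p := \prod_(i < n) a i.
  rewrite -[LHS]mulr1 -uy.
  have -> : f * p * ((1 - f * a n * c) * y) = y * (f * p - (f * f) * p * a n * c).
    by ring.
  by rewrite ff; ring.
move=> a an.
have [g gP] := choice (fun k => block (fun i => a (k + i)%N) (fun i => an _)).
pose K j := iter j (fun k => k + g k)%N 0%N.
pose b j := f * \prod_(i < g (K j)) a (K j + i)%N.
have [j|n bn] := Ntn (a := b); first exact: gP.
exists (K n); have -> : f * \prod_(i < K n) a i = f * \prod_(j < n) b j.
  elim: n {bn} => [|n IHn]; first by rewrite !big_ord0.
  rewrite [K n.+1]iterS -/(K n) big_split_ord mulrA IHn big_ord_recr /=.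
  rewrite [b n]/b; move: (\prod_(i < n) b i) (\prod_(i < _) _) => P Q.
  by rewrite -{1}ff; ring.
by rewrite bn mulr0.
Qed.

Lemma dcc_mod_pi_regular f x : f * f = f -> dcc_mod f ->
  exists m c, f * x ^+ m.+1 = f * x ^+ m.+2 * c.
Proof.
move=> ff Df; have [n [c]] := Df (fun=> x).
rewrite !prodr_const !card_ord => /N_nilp[k].
have expand : exists d, (1 - x * c) ^+ k = 1 - x * d.
  elim: k => [|k [d IHk]]; first by exists 0; rewrite mulr0 subr0.
  by exists (d + c - x * c * d); rewrite exprS IHk; ring.
have [d xd] := expand.
have -> : f * (x ^+ n - x ^+ n.+1 * c) = f * x ^+ n * (1 - x * c).
  by rewrite exprS; ring.
case: k xd {expand} => [|k] xd.
  by move=> /eqP; rewrite expr0 oner_eq0.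
have fX j : f ^+ j.+1 = f by elim: j => // j IHj; rewrite exprS IHj.
rewrite exprMn xd exprMn fX -exprM; set m := (n * k.+1)%N => h.
exists m, d; apply/eqP; rewrite -subr_eq0.
have -> : f * x ^+ m.+1 - f * x ^+ m.+2 * d = x * (f * x ^+ m * (1 - x * d)).
  by rewrite !exprS; ring.
by rewrite h mulr0.
Qed.

(** By the chain condition for the powers of [x], some power of [x] generates
    in [f C] the same ideal as an idempotent [g].  If [g] is neither [0] nor [f]
    for some [x], then [f] splits. *)
Lemma dcc_mod_split f : f * f = f -> dcc_mod f ->
  local_idem f \/ exists g, [/\ g * g = g, f * g = g, g <> 0 & g <> f].
Proof.
move=> ff Df; apply: contrapT => /not_orP[nloc /forallNP nsplit].
apply: nloc; split=> // x.
have [m [c xc]] := dcc_mod_pi_regular x ff Df.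
have fx j : f * x ^+ m.+1 = f * x ^+ (m.+1 + j) * c ^+ j.
  elim: j => [|j IHj]; first by rewrite addn0 mulr1.
  have -> : f * x ^+ (m.+1 + j.+1) * c ^+ j.+1 =
      f * x ^+ m.+2 * c * (x ^+ j * c ^+ j).
    by rewrite addnS -addSn exprD [c ^+ j.+1]exprS; ring.
  by rewrite -xc [LHS]IHj exprD; ring.
pose g := f * x ^+ m.+1 * c ^+ m.+1.
have fgx : f * x ^+ m.+1 = g * x ^+ m.+1.
  by rewrite /g [LHS](fx m.+1) exprD; ring.
have fg : f * g = g by rewrite /g !mulrA ff.
have gg : g * g = g.
  have -> : g * g = g * x ^+ m.+1 * (f * c ^+ m.+1) by rewrite /g; ring.
  by rewrite -fgx -[RHS]/(f * x ^+ m.+1 * c ^+ m.+1) -{3}ff; ring.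
have [g0|g0] := pselect (g = 0).
  left; exists m.+1; rewrite exprMn.
  have fX j : f ^+ j.+1 = f by elim: j => // j IHj; rewrite exprS IHj.
  by rewrite fX fgx g0 mul0r.
have [gf|gf] := pselect (g = f); last by case: (nsplit g).
right; exists (x ^+ m * c ^+ m.+1).
by apply: etrans gf; rewrite /g [x ^+ m.+1]exprS; ring.
Qed.

(** If [e] is not such a sum, then splitting it repeatedly, and keeping each time
    a part that is not such a sum, gives a strictly decreasing sequence of
    idempotents.  By the chain condition two successive terms agree modulo [N],
    up to a multiple; but then their difference is a nilpotent idempotent. *)
Lemma dcc_mod_local_decomp e : e * e = e -> dcc_mod e ->
  exists s, local_decomp e s.
Proof.
move=> ee De; apply: contrapT => nes.
pose bad f := [/\ f * f = f, dcc_mod f & ~ exists s, local_decomp f s].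
have step f : exists g, bad f -> [/\ bad g, f * g = g & g <> f].
  have [[ff Df nf]|] := pselect (bad f); last by exists 0.
  have [floc|[g [gg fg g0 gf]]] := dcc_mod_split ff Df.
    case: nf; exists [:: f]; split=> [|x]; first by rewrite big_seq1.
    by rewrite inE => /eqP ->; split=> //; apply: dcc_mod_tnilp.
  have hh : (f - g) * (f - g) = f - g.
    have -> : (f - g) * (f - g) = f * f - f * g - (f * g - g * g) by ring.
    by rewrite ff gg fg subrr subr0.
  have fh : f * (f - g) = f - g by rewrite mulrBr ff fg.
  have [[s [sg sP]]|ng] := pselect (exists s, local_decomp g s); last first.
    by exists g => _; split=> //; split=> //; apply: dcc_mod_sub fg.
  have [[t [tg tP]]|nh] := pselect (exists s, local_decomp (f - g) s); last first.
    exists (f - g) => _; split=> //; first by split=> //; apply: dcc_mod_sub fh.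
    by move=> /eqP; rewrite -subr_eq0 addrC addKr oppr_eq0 => /eqP.
  case: nf; exists (s ++ t); split; first by rewrite big_cat /= sg tg addrC subrK.
  by move=> x; rewrite mem_cat => /orP[/sP|/tP].
have [phi phiP] := choice step.
pose st k := iter k phi e.
have stbad k : bad (st k).
  by elim: k => [|k IHk]; [split | rewrite /st iterS; case: (phiP _ IHk)].
have stS k : st k * st k.+1 = st k.+1 by case: (phiP _ (stbad k)).
have est n : e * \prod_(i < n) st i.+1 = st n.
  elim: n => [|n IHn]; first by rewrite big_ord0 mulr1.
  by rewrite big_ord_recr mulrA IHn stS.
have [n [c]] := De (fun i => st i.+1); rewrite mulrBr mulrA !est.
move=> /(NM (1 - st n.+1)) /N_nilp.
have [gg _ _] := stbad n.+1; have [ff _ _] := stbad n.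
have fg := stS n; have [_ _ gf] := phiP _ (stbad n).
have -> : (1 - st n.+1) * (st n - st n.+1 * c) = st n - st n.+1.
  have -> : (1 - st n.+1) * (st n - st n.+1 * c) =
    st n - st n * st n.+1 - st n.+1 * c + st n.+1 * st n.+1 * c by ring.
  by rewrite fg gg; ring.
move=> h; apply/gf/eqP; rewrite -/(st n.+1) eq_sym -subr_eq0; apply/eqP.
apply: nilp_idem h.
have -> : (st n - st n.+1) * (st n - st n.+1) =
  st n * st n - st n * st n.+1 - (st n * st n.+1 - st n.+1 * st n.+1) by ring.
by rewrite ff fg gg; ring.
Qed.

End ChainCondition.

(** * Semilocal rings of dimension zero *)

Section Ideals.
Variable A : comNzRingType.
Implicit Types (I M P : set A).

Definition ideal_adjoin I x : set A := fun z => exists y u, I y /\ z = y + x * u.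

Lemma ideal_adjoinP I x : is_ideal I ->
  [/\ is_ideal (ideal_adjoin I x), I `<=` ideal_adjoin I x
    & ideal_adjoin I x x].
Proof.
case=> I0 ID IM; split; last by exists 0, 1; rewrite add0r mulr1.
  split; first by exists 0, 0; rewrite mulr0 addr0.
    move=> _ _ [y [u [Iy ->]]] [z [v [Iz ->]]]; exists (y + z), (u + v).
    by split; [exact: ID | ring].
  move=> a _ [y [u [Iy ->]]]; exists (a * y), (a * u).
  by split; [exact: IM | ring].
by move=> y Iy; exists y, 0; rewrite mulr0 addr0.
Qed.

(** Zorn's lemma.  Taking [a = 1] gives a prime containing a given proper
    ideal. *)
Lemma ideal_prime_avoiding I a : is_ideal I -> (forall n, ~ I (a ^+ n)) ->
  exists2 P, prime_ideal P & I `<=` P /\ ~ P a.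
Proof.
move=> Iid Ia.
pose avoids X := [/\ is_ideal X, I `<=` X & forall n, ~ X (a ^+ n)].
(* The empty set is admitted because it is the union of the empty chain. *)
have [F sub Ftot|P [[P0|Pav] Pmax]] := @Zorn_bigcup A (fun X => X = set0 \/ avoids X).
- have [/existsNP[X]|allN] := pselect (~ forall X, F X -> ~ avoids X); last first.
    left; apply/seteqP; split=> // x [X FX Xx].
    have [X0|] := sub _ FX; first by rewrite X0 in Xx.
    by move: allN => /contrapT/(_ X FX).
  move=> /not_implyP[FX /contrapT [[X0 XD XM] IX Xa]]; right; split.
  + split; first by exists X.
      move=> x y [Y FY Yx] [Z FZ Zy].
      have idl W w : F W -> W w -> is_ideal W.
        by move=> /sub[-> //|[]].
      have [YZ|ZY] := Ftot _ _ FY FZ.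
        have [_ D _] := idl _ _ FZ Zy; exists Z => //; apply: D => //; exact: YZ.
      have [_ D _] := idl _ _ FY Yx; exists Y => //; apply: D => //; exact: ZY.
    move=> u x [Y FY Yx]; exists Y => //.
    by have [Y0|[[_ _ M] _ _]] := sub _ FY; [rewrite Y0 in Yx | apply: M].
  + by move=> x Ix; exists X => //; apply: IX.
  + by move=> n [Y /sub[-> //|[_ _]]]; apply.
- have [] := Pmax I; last by right; split.
  by rewrite P0; split=> // sI; have [/sI] := Iid.
have [Pid IP Pa] := Pav.
have grow x : ~ P x -> exists n y u, P y /\ a ^+ n = y + x * u.
  move=> nPx; have [Qid PQ Qx] := ideal_adjoinP x Pid.
  apply: contrapT => nn; apply: (Pmax (ideal_adjoin P x)).
    by split=> // QP; apply/nPx/QP.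
  right; split=> //; first exact: subset_trans PQ.
  by move=> n [y [u yu]]; apply: nn; exists n, y, u.
have [P0' PD PM] := Pid.
exists P; last by split=> //; move: (Pa 1%N); rewrite expr1.
split=> [//||x y Pxy]; first by move: (Pa 0%N).
apply: contrapT => /not_orP[/grow[n [z [u [Pz an]]]] /grow[m [w [v [Pw am]]]]].
apply: (Pa (n + m)%N); rewrite exprD an am.
have -> : (z + x * u) * (w + y * v) = (w + y * v) * z + x * u * w + u * v * (x * y).
  by ring.
by apply: (PD); [apply: (PD)|]; apply: PM.
Qed.

Lemma maximal_ideal_unit M x : maximal_ideal M -> ~ M x ->
  exists y u, M y /\ 1 = y + x * u.
Proof.
case=> Mid M1 Mmax nMx; have [Qid MQ Qx] := ideal_adjoinP x Mid.
apply: contrapT => nn; apply: nMx; rewrite -(Mmax _ Qid) //.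
Qed.

Lemma maximal_ideal_prime M : maximal_ideal M -> prime_ideal M.
Proof.
move=> Mm; have [Mid M1 _] := Mm; have [M0 MD MM] := Mid.
split=> // x y Mxy; apply: contrapT => /not_orP[nMx nMy].
have [z [u [Mz xu]]] := maximal_ideal_unit Mm nMx.
apply: nMy; rewrite -[y]mulr1 xu.
have -> : y * (z + x * u) = y * z + u * (x * y) by ring.
by apply: MD; apply: MM.
Qed.

Lemma prime_ideal_nil P x : prime_ideal P -> nil_elt x -> P x.
Proof.
move=> [[P0 _ _] P1 PM] [n xn].
have : P (x ^+ n) by rewrite xn.
by elim: n {xn} => [//|n IHn]; rewrite exprS => /PM[].
Qed.

Lemma dim0_prime_maximal P : has_krull_dim A 0 -> prime_ideal P -> maximal_ideal P.
Proof.
move=> [_ dim0] Pp; have [Pid P1 _] := Pp; split=> // I Iid I1 PI.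
apply: contrapT => IP.
have [|Q Qp [IQ _]] := ideal_prime_avoiding (a := 1) Iid.
  by move=> n; rewrite expr1n.
have /dim0 : prime_chain 1 (fun i => if i is 0 then P else Q); last by [].
split=> [[|i] //|[|i] //= _]; split; first exact: subset_trans IQ.
by move=> QP; apply: IP; apply/seteqP; split=> // x /IQ /QP.
Qed.

Lemma dim0_nil_avoid (x : A) : has_krull_dim A 0 -> ~ nil_elt x ->
  exists2 M : set A, maximal_ideal M & ~ M x.
Proof.
move=> dim0 nx; have [||P Pp [_ Px]] := @ideal_prime_avoiding [set 0] x.
- by split=> [//|y z -> -> /=|a y -> /=]; rewrite ?addr0 ?mulr0.
- by move=> n xn; apply: nx; exists n.
by exists P => //; apply: dim0_prime_maximal.
Qed.

Lemma dim0_jacobson : has_krull_dim A 0 ->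
  jacobson_radical A = [set x | nil_elt x].
Proof.
move=> dim0; apply/seteqP; split=> x /= Jx; last first.
  by move=> M Mm; apply: prime_ideal_nil Jx; apply: maximal_ideal_prime.
by apply: contrapT => /(dim0_nil_avoid dim0)[M Mm]; apply; apply: Jx.
Qed.

End Ideals.

(** Since there are finitely many maximal ideals, at some [n] the partial product
    [p n] lies in every maximal ideal that contains a later one.  The ideal
    generated by [p n.+1] and the intersection [L] of the maximal ideals that
    avoid [p n] is then the whole ring, and [p n] times [L] lies in all maximal
    ideals. *)
Lemma semilocal_dcc (R : comNzRingType) : semilocal R -> has_krull_dim R 0 ->
  dcc_mod [set x | nil_elt x] (1 : R).
Proof.
move=> /finite_seqP[s sP] dim0 a.
have smax M : M \in s <-> maximal_ideal M.
  by have := congr1 (fun X => X M) sP => /= ->.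
pose p n := \prod_(i < n) a i.
have Mid M : M \in s -> is_ideal M by move/smax => [].
have pS M n m : M \in s -> (n <= m)%N -> M (p n) -> M (p m).
  move=> /Mid [_ _ MM] nm Mp; elim: m nm => [|m IHm].
    by rewrite leqn0 => /eqP <-.
  rewrite leq_eqVlt => /orP[/eqP <- //|nm].
  by rewrite /p big_ord_recr /= mulrC; apply/MM/IHm.
have [n nP] : exists n, forall M k, M \in s -> M (p k) -> M (p n).
  have : {subset s <= s} by [].
  move: {1 3}s => t; elim: t => [|M t IHt] ts.
    by exists 0%N.
  have [|n nP] := IHt; first by move=> X Xt; apply: ts; rewrite inE Xt orbT.
  have Ms : M \in s by apply: ts; rewrite mem_head.
  have [[k Mk]|nM] := pselect (exists k, M (p k)); last first.
    exists n => X k; rewrite inE => /orP[/eqP -> Mk|]; first by case: nM; exists k.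
    exact: nP.
  exists (maxn n k) => X j; rewrite inE => /orP[/eqP -> _|Xt Xj].
    exact: pS (leq_maxr _ _) Mk.
  apply: pS (leq_maxl _ _) (nP _ _ Xt Xj).
  by apply: ts; rewrite inE Xt orbT.
pose L : set R := fun x => forall M, M \in s -> ~ M (p n) -> M x.
have Lid : is_ideal L.
  split=> [M /Mid[]//|x y Lx Ly M Ms Mp|u x Lx M Ms Mp].
    by have [_ MD _] := Mid _ Ms; apply: MD; [exact: (Lx M) | exact: (Ly M)].
  by have [_ _ MM] := Mid _ Ms; apply: MM; exact: (Lx M).
have Lavoid M : maximal_ideal M -> M (p n) -> exists2 x, L x & ~ M x.
  move=> Mm Mp; have [_ M1 Mpr] := maximal_ideal_prime Mm.
  have : {subset s <= s} by [].
  rewrite /L; move: {1 3}s => t; elim: t => [|X t IHt] ts.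
    by exists 1.
  have [|x tx Mx] := IHt; first by move=> Y Yt; apply: ts; rewrite inE Yt orbT.
  have Xs : X \in s by apply: ts; rewrite mem_head.
  have [Xp|Xp] := pselect (X (p n)).
    by exists x => // Y; rewrite inE => /orP[/eqP -> //|]; apply: tx.
  have [/existsNP[y /not_implyP[Xy My]]|XM] := pselect (~ (X `<=` M)); last first.
    have [Xid X1 Xmax] : maximal_ideal X by apply/smax.
    move: XM => /contrapT XM; case: Xp; rewrite -(Xmax M) //.
    by case: Mm.
  exists (x * y) => [Y|/Mpr[]//]; rewrite inE => /orP[/eqP -> _|Yt Yp].
    by have [_ _ XM] := Mid _ Xs; apply: XM.
  have [_ _ YM] : is_ideal Y by apply: Mid; apply: ts; rewrite inE Yt orbT.
  by rewrite mulrC; apply: YM; exact: (tx Y).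
have [Qid LQ Qp] := ideal_adjoinP (p n.+1) Lid.
have [l [c [Ll lc]]] : ideal_adjoin L (p n.+1) 1.
  apply: contrapT => Q1.
  have [|P Pp [QP _]] := ideal_prime_avoiding (a := 1) Qid.
    by move=> k; rewrite expr1n.
  have Pm := dim0_prime_maximal dim0 Pp.
  have Ps : P \in s by apply/smax.
  have Ppn := nP _ n.+1 Ps (QP _ Qp).
  by have [x Lx] := Lavoid _ Pm Ppn; apply; apply/QP/LQ.
exists n, (p n * c); rewrite mul1r -/(p n) -/(p n.+1) /=.
have -> : p n - p n.+1 * (p n * c) = p n * l.
  by rewrite -{1}[p n]mulr1 lc; ring.
apply: contrapT => /(dim0_nil_avoid dim0)[M Mm]; apply.
have Ms : M \in s by apply/smax.
have [_ _ MM] := Mid _ Ms.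
have [Mp|Mp] := pselect (M (p n)); first by rewrite mulrC; apply: MM.
by apply: MM; exact: (Ll M).
Qed.

Definition nil_tnilp (R : comNzRingType) : Prop :=
  forall a : nat -> R, (forall i, nil_elt (a i)) -> exists n, \prod_(i < n) a i = 0.

Lemma semilocal_local_decomp (R : comNzRingType) :
  semilocal R -> has_krull_dim R 0 -> nil_tnilp R ->
  exists s : seq R, local_decomp 1 s.
Proof.
move=> Rs R0 Rt.
apply: (dcc_mod_local_decomp (N := [set x | nil_elt x])) => //.
- by move=> x y; apply: nilpMl.
- by rewrite mulr1.
- exact: semilocal_dcc.
Qed.

(** * Finite flat modules along polynomial extensions *)

Section FiniteFlat.
Variables (A S : comNzRingType).

Definition finmod (phi : A -> S) (B : lmodType S) : Prop :=
  exists (K : finType) (w : K -> B), forall x, exists a : K -> A,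
    x = \sum_i phi (a i) *: w i.

(** Flatness over [e A], by the equational criterion; [B] is an [A]-module
    through [phi]. *)
Definition flatmod (e : A) (phi : A -> S) (B : lmodType S) : Prop :=
  forall (K : finType) (a : K -> A) (b : K -> B), \sum_i phi (a i) *: b i = 0 ->
  exists (L : finType) (c : K -> L -> A) (y : L -> B),
    (forall i, b i = \sum_l phi (c i l) *: y l) /\
    (forall l, e * \sum_i a i * c i l = 0).

Lemma flatmod1 e phi (B : lmodType S) a (b : B) :
  flatmod e phi B -> phi a *: b = 0 ->
  exists (L : finType) (c : L -> A) (y : L -> B),
    b = \sum_l phi (c l) *: y l /\ forall l, e * (a * c l) = 0.
Proof.
move=> Bflat ab0; have [|L [c [y [bc ec]]]] := Bflat unit (fun=> a) (fun=> b).
  by rewrite (big_pred1 tt) // => -[].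
exists L, (c tt), y; split=> [|l]; first exact: bc tt.
by have := ec l; rewrite (big_pred1 tt) // => -[].
Qed.

End FiniteFlat.

Lemma poly_expand (A : comNzRingType) n (p : {poly A}) : (size p <= n)%N ->
  p = \sum_(l < n) (p`_l)%:P * 'X^l.
Proof.
move=> pn; apply/polyP => j; rewrite coef_sum.
have [jn|nj] := ltnP j n.
  rewrite (bigD1 (Ordinal jn)) //= coefCM coefXn eqxx mulr1 big1 ?addr0 // => l.
  by rewrite -val_eqE /= coefCM coefXn eq_sym => /negPf ->; rewrite mulr0.
rewrite nth_default ?(leq_trans pn) // big1 // => l _.
by rewrite coefCM coefXn gtn_eqF ?mulr0 // (leq_trans _ nj).
Qed.

(** A monic polynomial is a non-zero-divisor modulo any ideal of constants:
    the quotients of a division by [p] solve the relation. *)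
Lemma monic_combination (A : comNzRingType) (e : A) (p : {poly A}) (K : finType)
    (a : K -> A) (c : K -> {poly A}) (d : {poly A}) :
  p \is monic -> e%:P * (p * d - \sum_i (a i)%:P * c i) = 0 ->
  e%:P * d = e%:P * \sum_i (a i)%:P * rdivp (c i) p.
Proof.
move=> pm rel; apply/eqP; rewrite -subr_eq0 -mulrBr; apply/eqP.
set f := e%:P * _; apply/eqP; apply: contraT => f0.
have fp : f * p = e%:P * \sum_i (a i)%:P * rmodp (c i) p.
  apply/eqP; rewrite -subr_eq0 -[X in _ == X]rel; apply/eqP.
  rewrite /f -!mulrA -mulrBr; congr (_ * _).
  rewrite mulrBl [d * p]mulrC -addrA -opprD; congr (_ - _).
  rewrite mulr_suml -big_split /=; apply: eq_bigr => i _.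
  by rewrite [in RHS](Pdiv.RingMonic.rdivp_eq pm (c i)) mulrDr mulrA.
have : (size (f * p)%R < size p)%N.
  rewrite fp mul_polyC (leq_ltn_trans (size_scale_leq _ _)) //.
  rewrite -(prednK (n := size p)) ?size_poly_gt0 ?monic_neq0 // ltnS.
  apply: (leq_trans (size_sum _ _ _)); apply/bigmax_leqP => i _.
  rewrite -ltnS prednK ?size_poly_gt0 ?monic_neq0 //.
  rewrite mul_polyC (leq_ltn_trans (size_scale_leq _ _)) //.
  by rewrite Pdiv.Ring.ltn_rmodpN0 ?monic_neq0.
rewrite size_Mmonic // -(prednK (n := size f)) ?size_poly_gt0 //.
by rewrite addSn /= ltnNge leq_addl.
Qed.

Section FiniteFlatQuotient.
Variables (A S : comNzRingType) (phi : {rmorphism {poly A} -> S}) (e : A).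
Variables (B B' : lmodType S) (q : {linear B -> B'}) (g g' : S) (p : {poly A}).
Hypotheses (qsurj : forall y, exists x, q x = y)
  (qker : forall x, q x = 0 <-> exists y, x = g *: y)
  (pmonic : p \is monic) (phip : forall x : B, phi p *: x = (g * g') *: x)
  (phie : forall x : B, phi e%:P *: x = x).

Lemma phi_expand n (a : {poly A}) (x : B) : (size a <= n)%N ->
  phi a *: x = \sum_(l < n) phi (a`_l)%:P *: (phi 'X^l *: x).
Proof.
move=> an; rewrite {1}(poly_expand an) rmorph_sum scaler_suml.
by apply: eq_bigr => l _; rewrite rmorphM scalerA.
Qed.

(** The remainders of the divisions by [p] suffice, since [p] maps into the
    multiples of [g]. *)
Lemma quotient_finmod : finmod phi B -> finmod (fun c => phi c%:P) B'.
Proof.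
case=> K [w wP]; pose D := (size p).-1.
exists (K * 'I_D)%type, (fun i => q (phi 'X^(val i.2) *: w i.1)) => x'.
have [x <-] := qsurj x'; have [a ->] := wP x.
exists (fun i => (rmodp (a i.1) p)`_(val i.2)).
rewrite linear_sum -(pair_bigA _ (fun i l =>
  phi ((rmodp (a i) p)`_(val l))%:P *: q (phi 'X^(val l) *: w i))) /=.
apply: eq_bigr => i _.
have -> : phi (a i) *: w i = g *: (phi (rdivp (a i) p) *: (g' *: w i)) +
    phi (rmodp (a i) p) *: w i.
  rewrite {1}(Pdiv.RingMonic.rdivp_eq pmonic (a i)) rmorphD rmorphM scalerDl.
  by rewrite -scalerA phip !scalerA; congr (_ *: _ + _); ring.
rewrite linearD (qker _).2 ?add0r; last by eexists.
have szr : (size (rmodp (a i) p) <= D)%N.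
  rewrite -ltnS prednK ?size_poly_gt0 ?monic_neq0 //.
  by rewrite Pdiv.Ring.ltn_rmodpN0 ?monic_neq0.
rewrite (phi_expand _ szr) linear_sum; apply: eq_bigr => l _.
by rewrite linearZ.
Qed.

Lemma flatmod_const : flatmod e%:P phi B -> flatmod e (fun c => phi c%:P) B.
Proof.
move=> Bflat K a b ab0.
have [L [c [y [bc ec]]]] := Bflat K (fun i => (a i)%:P) b ab0.
pose D := \max_(i : K * L) size (c i.1 i.2).
exists (L * 'I_D)%type, (fun i l => (c i l.1)`_(val l.2)),
  (fun l => phi 'X^(val l.2) *: y l.1); split=> [i|[l m]] /=.
  rewrite bc -(pair_bigA _ (fun l m =>
    phi ((c i l)`_(val m))%:P *: (phi 'X^(val m) *: y l))) /=.
  apply: eq_bigr => l _; apply: phi_expand.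
  exact: (leq_bigmax (i, l)).
have := congr1 (fun d : {poly A} => d`_m) (ec l).
rewrite coef0 coefCM coef_sum; apply: etrans; congr (_ * _).
by apply: eq_bigr => i _; rewrite coefCM.
Qed.

Lemma phie_eq (c d : {poly A}) (x : B) : e%:P * c = e%:P * d ->
  phi c *: x = phi d *: x.
Proof.
move=> cd; rewrite -[LHS]phie -[RHS]phie !scalerA -!rmorphM.
by rewrite cd.
Qed.

(** [B] is flat over the ring [A] of constants by [flatmod_const].  A relation
    in [B / g B] lifts to one in [B] up to an element [g y], and [y] belongs to
    the ideal of the [a i]: multiplying by [g'] turns [g y] into [p y], and [p]
    is regular modulo this ideal.  Correcting the lift by [y] leaves a relation
    in [B]. *)
Lemma quotient_flatmod : flatmod e%:P phi B -> flatmod e (fun c => phi c%:P) B'.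
Proof.
move=> Bflat K a b'; have [b bP] := choice (fun i => qsurj (b' i)).
under eq_bigr do rewrite -bP -linearZ; rewrite -linear_sum => /qker[y by_].
have [t yt] : exists t : K -> B, y = \sum_i phi (a i)%:P *: t i.
  (* The relation [p y = \sum_i a i (g' b i)], where [inl tt] is the index of
     [y]. *)
  have [|L [c [z [xc ec]]]] := Bflat (unit + K)%type
      (fun i => match i with inl _ => p | inr i => - (a i)%:P end)
      (fun i => match i with inl _ => y | inr i => g' *: b i end).
    rewrite big_sumType /= (big_pred1 tt) => [|[] //].
    rewrite phip mulrC -scalerA -by_ scaler_sumr -big_split /= big1 // => i _.
    by rewrite rmorphN scaleNr !scalerA mulrC subrr.
  exists (fun i => \sum_l phi (rdivp (c (inr i) l) p) *: z l).
  rewrite [LHS](xc (inl tt)).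
  under [RHS]eq_bigr do rewrite scaler_sumr.
  rewrite [RHS]exchange_big; apply: eq_bigr => l _ /=.
  have := ec l; rewrite big_sumType /= (big_pred1 tt) => [|[] //].
  under eq_bigr do rewrite mulNr; rewrite sumrN.
  move=> /(monic_combination pmonic)/phie_eq ->.
  rewrite rmorph_sum scaler_suml; apply: eq_bigr => i _.
  by rewrite rmorphM scalerA.
have [|L [c [z [bz ec]]]] := flatmod_const Bflat (a := a) (b := fun i => b i - g *: t i).
  under eq_bigr do rewrite scalerBr.
  rewrite sumrB by_ yt scaler_sumr; apply/eqP; rewrite subr_eq0; apply/eqP.
  by apply: eq_bigr => i _; rewrite !scalerA mulrC.
exists L, c, (fun l => q (z l)); split=> // i.
have -> : b' i = q (b i - g *: t i).
  by rewrite linearB bP (qker (g *: t i)).2 ?subr0 //; exists (t i).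
by rewrite bz linear_sum; apply: eq_bigr => l _; rewrite linearZ.
Qed.

End FiniteFlatQuotient.

(** * Linear dependence modulo a prime ideal *)

Section PrimeDependence.
Variables (A : comNzRingType) (P : set A) (Pp : prime_ideal P).

Lemma prime_dependence r (v : 'I_r.+1 -> 'I_r -> A) :
  exists s : 'I_r.+1 -> A, (exists i, ~ P (s i)) /\
    forall j, P (\sum_i s i * v i j).
Proof.
have [[P0 PD PM] P1 Pprime] := Pp; elim: r v => [|r IHr] v.
  by exists (fun=> 1); split=> [|[]//]; exists ord0.
have [vP|/existsNP[i0 vi0]] := pselect (forall i, P (v i ord0)).
  have [s [[i si] sP]] := IHr (fun i j => v (lift ord0 i) (lift ord0 j)).
  exists (fun i => if unlift ord0 i is Some k then s k else 0); split.
    by exists (lift ord0 i); rewrite liftK.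
  move=> j; rewrite big_ord_recl unlift_none mul0r add0r.
  under eq_bigr do rewrite liftK.
  have [k ->|->] := unliftP ord0 j; first exact: sP.
  by elim/big_rec: _ => // k x _ Px; apply: PD => //; apply/PM/vP.
have [s [[i si] sP]] := IHr (fun i j =>
  v i0 ord0 * v (lift i0 i) (lift ord0 j) - v (lift i0 i) ord0 * v i0 (lift ord0 j)).
exists (fun i => if unlift i0 i is Some k then v i0 ord0 * s k
  else - \sum_k s k * v (lift i0 k) ord0); split.
  by exists (lift i0 i); rewrite liftK => /Pprime[].
move=> j; rewrite (bigD1_ord i0) //= unlift_none.
under [X in _ + X]eq_bigr do rewrite liftK.
rewrite mulNr mulr_suml -sumrN -big_split /=.
have [k ->|->] := unliftP ord0 j.
  rewrite (eq_bigr (fun l => s l * (v i0 ord0 * v (lift i0 l) (lift ord0 k) -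
    v (lift i0 l) ord0 * v i0 (lift ord0 k)))) ?sP // => l _.
  by ring.
rewrite big1 // => l _.
by ring.
Qed.

(** [P B], where [B] is an [A]-module through [phi]. *)
Definition prime_span (S : comNzRingType) (phi : A -> S) (B : lmodType S)
    (x : B) : Prop :=
  exists (K : finType) (u : K -> A) (w : K -> B),
    (forall i, P (u i)) /\ x = \sum_i phi (u i) *: w i.

Lemma finmod_dependence (S : comNzRingType) (phi : {rmorphism A -> S})
    (B : lmodType S) :
  finmod phi B -> exists r, forall x : 'I_r.+1 -> B,
  exists s : 'I_r.+1 -> A, (exists i, ~ P (s i)) /\
    prime_span phi (\sum_i phi (s i) *: x i).
Proof.
case=> K [w wP]; exists #|K| => x.
have [a xa] := choice (fun i => wP (x i)).
have [s [sn sP]] := prime_dependence (fun i j => a i (enum_val j)).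
exists s; split=> //; exists K, (fun k => \sum_i s i * a i k), w; split.
  by move=> k; have := sP (enum_rank k); under eq_bigr do rewrite enum_rankK.
under [RHS]eq_bigr do rewrite rmorph_sum scaler_suml.
rewrite exchange_big; apply: eq_bigr => i _ /=.
rewrite {1}xa scaler_sumr; apply: eq_bigr => k _.
by rewrite rmorphM scalerA.
Qed.

Lemma prime_span_submodule (S : comNzRingType) (phi : A -> S) (B : lmodType S) :
  submodule (prime_span phi (B := B)).
Proof.
split; first by exists 'I_0, (fun _ => 0), (fun _ => 0); rewrite big_ord0; split=> [[]|].
move=> c _ _ [K [u [y [un ->]]]] [L [v [z [vn ->]]]].
exists (K + L)%type,
  (fun i => match i with inl i => u i | inr i => v i end),
  (fun i => match i with inl i => c *: y i | inr i => z i end); split; first by case.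
rewrite big_sumType /= scaler_sumr; congr (_ + _).
by apply: eq_bigr => i _; rewrite !scalerA mulrC.
Qed.

Lemma prime_span1 (S : comNzRingType) (phi : A -> S) (B : lmodType S) u (x : B) :
  P u -> prime_span phi (phi u *: x).
Proof.
move=> Pu; exists unit, (fun=> u), (fun=> x); split=> //.
by rewrite (big_pred1 tt) // => -[].
Qed.

End PrimeDependence.

(** * Polynomials over a local ring with nil maximal ideal *)

Section RMorphismExtensionality.

Lemma mpoly_rmorph_eq (R S : comNzRingType) d (f g : {rmorphism {mpoly R[d]} -> S}) :
  (forall c, f c%:MP = g c%:MP) -> (forall i, f 'X_i = g 'X_i) -> f =1 g.
Proof.
move=> fgC fgX p; rewrite [p]mpolyE !rmorph_sum; apply: eq_bigr => m _.
rewrite -mul_mpolyC !rmorphM fgC; congr (_ * _).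
rewrite mpolyXE_id !rmorph_prod; apply: eq_bigr => i _.
by rewrite !rmorphXn /= fgX.
Qed.

Lemma poly_rmorph_eq (A S : comNzRingType) (f g : {rmorphism {poly A} -> S}) :
  (forall c, f c%:P = g c%:P) -> f 'X = g 'X -> f =1 g.
Proof.
move=> fgC fgX p; rewrite (poly_expand (leqnn (size p))) !rmorph_sum.
by apply: eq_bigr => i _; rewrite !rmorphM fgC !rmorphXn /= fgX.
Qed.

End RMorphismExtensionality.

Lemma base_expansion_inj N n (f g : 'I_n -> nat) :
  (forall i, (f i < N)%N) -> (forall i, (g i < N)%N) ->
  (\sum_i f i * N ^ i)%N = (\sum_i g i * N ^ i)%N -> f =1 g.
Proof.
elim: n f g => [|n IHn] f g fN gN; first by move=> _ [].
have shift (h : 'I_n.+1 -> nat) : (\sum_i h i * N ^ i)%N =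
    ((\sum_i h (lift ord0 i) * N ^ i) * N + h ord0)%N.
  rewrite big_ord_recl expn0 muln1 addnC big_distrl /=; congr (_ + _)%N.
  by apply: eq_bigr => i _; rewrite /bump /= expnS -mulnA [(N * _)%N]mulnC.
rewrite !shift => fg.
have fg0 : f ord0 = g ord0.
  have := congr1 (modn^~ N) fg.
  by rewrite /= !modnMDl !modn_small.
move: fg; rewrite fg0 => /addIn/eqP; rewrite eqn_pmul2r ?(leq_ltn_trans _ (fN ord0)) //.
move=> /eqP fg i; have [j ->|-> //] := unliftP ord0 i.
by apply: (IHn (fun i => f (lift ord0 i)) (fun i => g (lift ord0 i))).
Qed.

Definition monic_deg (A : comNzRingType) k (p : {poly A}) : Prop :=
  p \is monic /\ size p = k.+1.

Lemma monic_deg1 (A : comNzRingType) : monic_deg 0 (1 : {poly A}).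
Proof. by split; [exact: monic1 | rewrite size_poly1]. Qed.

Lemma monic_degM (A : comNzRingType) k l (p q : {poly A}) :
  monic_deg k p -> monic_deg l q -> monic_deg (k + l) (p * q).
Proof.
move=> [pm pk] [qm ql]; split; first by rewrite monicMl.
by rewrite size_Mmonic ?monic_neq0 // pk ql addnS.
Qed.

Lemma monic_degX (A : comNzRingType) k n (p : {poly A}) :
  monic_deg k p -> monic_deg (n * k) (p ^+ n).
Proof.
move=> pk; elim: n => [|n IHn]; first exact: monic_deg1.
by rewrite exprS mulSn; apply: monic_degM.
Qed.

Lemma monic_deg_prod (A : comNzRingType) (I : finType) (k : I -> nat)
    (p : I -> {poly A}) :
  (forall i, monic_deg (k i) (p i)) -> monic_deg (\sum_i k i) (\prod_i p i).
Proof.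
move=> pk; apply: (big_ind2 (fun k p => monic_deg k p)) => //.
  exact: monic_deg1.
by move=> *; apply: monic_degM.
Qed.

Section NoetherVariables.
Variables (R : comNzRingType) (d N : nat).
Local Notation A := {mpoly R[d]}.
Local Notation A1 := {mpoly R[d.+1]}.

(** Substituting ['X_j + 'X_0 ^ (N ^ j)] for ['X_j] when [0 < j], and regarding
    the result as a polynomial in ['X_0] over the other variables: distinct
    monomials with exponents less than [N] become monic of distinct degrees,
    the numbers with the exponents as digits in base [N]. *)
Definition noether_var (i : 'I_d.+1) : {poly A} :=
  (if unlift ord0 i is Some j then 'X_j else 0)%:P + 'X^(N ^ i).

Definition noether_old_var (j : 'I_d) : A1 :=
  'X_(lift ord0 j) - 'X_ord0 ^+ (N ^ j.+1).

Definition noether : {rmorphism A1 -> {poly A}} :=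
  mmap (polyC \o @mpolyC d R) noether_var.

Definition noether_old : {rmorphism A -> A1} :=
  mmap (@mpolyC d.+1 R) noether_old_var.

Definition noether_inv : {rmorphism {poly A} -> A1} :=
  horner_eval 'X_ord0 \o map_poly noether_old.

Arguments noether : simpl never.
Arguments noether_old : simpl never.
Arguments noether_inv : simpl never.

Lemma noetherC c : noether c%:MP = c%:MP%:P.
Proof. exact: mmapC. Qed.

Lemma noetherX i : noether 'X_i = noether_var i.
Proof. by rewrite [LHS]mmapX mmap1U. Qed.

Lemma noether_oldC c : noether_old c%:MP = c%:MP.
Proof. exact: mmapC. Qed.

Lemma noether_oldX i : noether_old 'X_i = noether_old_var i.
Proof. by rewrite [LHS]mmapX mmap1U. Qed.

Lemma noether_invC c : noether_inv c%:P = noether_old c.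
Proof. by rewrite /noether_inv /= map_polyC /horner_eval hornerC. Qed.

Lemma noether_invX : noether_inv 'X = 'X_ord0.
Proof. by rewrite /noether_inv /= map_polyX /horner_eval hornerX. Qed.

Lemma noetherK : cancel noether noether_inv.
Proof.
apply: (mpoly_rmorph_eq (f := noether_inv \o noether) (g := idfun)) => [c|i].
  by rewrite -[LHS]/(noether_inv (noether c%:MP)) noetherC noether_invC noether_oldC.
rewrite -[LHS]/(noether_inv (noether 'X_i)) noetherX rmorphD rmorphXn noether_invC noether_invX.
have [j ->|->] := unliftP ord0 i.
  by rewrite [X in noether_old X]/('X_j) noether_oldX subrK.
by rewrite [X in noether_old X]/0 rmorph0 add0r expr1.
Qed.

Lemma noether_invK : cancel noether_inv noether.
Proof.
apply: (poly_rmorph_eq (f := noether \o noether_inv) (g := idfun)) => [c|].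
  rewrite -[LHS]/(noether (noether_inv c%:P)) noether_invC.
  move: c; apply: (mpoly_rmorph_eq (f := noether \o noether_old) (g := polyC)) => [c|i].
    by rewrite -[LHS]/(noether (noether_old c%:MP)) noether_oldC noetherC.
  rewrite -[LHS]/(noether (noether_old 'X_i)) noether_oldX rmorphB rmorphXn !noetherX /noether_var.
  by rewrite liftK unlift_none polyC0 add0r expr1; apply: addrK.
by rewrite -[LHS]/(noether (noether_inv 'X)) noether_invX noetherX /noether_var unlift_none add0r.
Qed.

Definition noether_weight (m : 'X_{1..d.+1}) : nat := \sum_i m i * N ^ i.

Lemma noether_monomial m : (0 < N)%N -> monic_deg (noether_weight m) (noether 'X_[m]).
Proof.
move=> N0; rewrite mpolyXE_id rmorph_prod; apply: monic_deg_prod => i.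
rewrite rmorphXn noetherX; apply: monic_degX.
have Ni : (0 < N ^ i)%N by rewrite expn_gt0 N0.
by split; rewrite /noether_var addrC; [apply: monicXnaddC | rewrite size_XnaddC].
Qed.

End NoetherVariables.

#[global] Opaque noether noether_old noether_inv.

Lemma seq_argmax (T : eqType) (f : T -> nat) (s : seq T) x :
  x \in s -> exists2 y, y \in s & forall z, z \in s -> (f z <= f y)%N.
Proof.
move=> xs; have [||m /hasP[y ys /eqP ym] mmax] :=
  @ex_maxnP (fun m => has (fun y => f y == m) s) (\max_(z <- s) f z).
- by exists (f x); apply/hasP; exists x.
- by move=> m /hasP[y ys /eqP <-]; exact: (leq_bigmax_seq y).
by exists y => // z zs; rewrite ym; apply: mmax; apply/hasP; exists z.
Qed.

Lemma bigD1_seq_cond (T : eqType) (V : nmodType) (s : seq T) (U : pred T) k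
    (F : T -> V) : uniq s -> k \in s -> U k ->
  \sum_(m <- s | U m) F m = F k + \sum_(m <- s | (m != k) && U m) F m.
Proof.
by move=> us ks Uk; rewrite big_mkcond (bigD1_seq k) //= Uk -big_mkcondr.
Qed.

Section LocalPolynomials.
Variables (R : comNzRingType) (e : R) (eloc : local_idem e) (en0 : e <> 0).

Let ee : e * e = e. Proof. by case: eloc. Qed.

(** The maximal ideal of [R] which corresponds to that of [e R]. *)
Definition local_max : set R := fun x => nil_elt (e * x).

Lemma local_max_unit x : ~ local_max x -> exists y, e * x * y = e.
Proof. by case: (eloc.2 x). Qed.

Lemma local_max_prime : prime_ideal local_max.
Proof.
split.
- split; first by rewrite /local_max mulr0; exact: nilp0.
    by move=> x y xn yn; rewrite /local_max mulrDr; apply: nilpD.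
  by move=> a x xn; rewrite /local_max mulrCA; apply: nilpMl.
- by rewrite /local_max mulr1 => /(nilp_idem ee).
move=> x y xy; apply: contrapT => /not_orP[nx]; apply.
have [u xu] := local_max_unit nx.
rewrite /local_max; have -> : e * y = u * (e * (x * y)) by rewrite -{1}xu; ring.
exact: nilpMl.
Qed.

Section Dim.
Variable d : nat.
Local Notation A := {mpoly R[d]}.

(** The kernel of the reduction of coefficients modulo the maximal ideal. *)
Definition nilcoef : set A := fun p => forall m, local_max p@_m.

Lemma nilcoef_ideal : is_ideal nilcoef.
Proof.
have [[M0 MD MM] _ _] := local_max_prime.
split=> [m|p q Pp Pq m|p q Pq m]; first by rewrite mcoeff0.
  by rewrite mcoeffD; apply: MD.
rewrite mcoeffM; elim/big_rec: _ => // k x _ Mx; apply: MD => //.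
exact: MM.
Qed.

(** Dropping the coefficients in the maximal ideal leaves a polynomial which is
    zero or whose leading coefficient is a unit of [e R]. *)
Definition unit_part (p : A) : A :=
  \sum_(m <- msupp p | ~~ `[< local_max p@_m >]) p@_m *: 'X_[m].

Lemma mcoeff_partial_sum (p : A) (Q : pred 'X_{1..d}) k :
  (\sum_(m <- msupp p | Q m) p@_m *: 'X_[m])@_k = if Q k then p@_k else 0.
Proof.
rewrite raddf_sum /=.
under eq_bigr do rewrite mcoeffZ mcoeffX.
have [kp|kp] := boolP (k \in msupp p); last first.
  rewrite memN_msupp_eq0 // if_same big_seq_cond big1 // => m /andP[mp _].
  by case: eqP mp kp => [-> ->|_] //; rewrite mulr0.
have [Qk|Qk] := boolP (Q k).
  rewrite big_mkcond (bigD1_seq k) ?msupp_uniq //= Qk eqxx mulr1.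
  rewrite big1 ?addr0 // => m /negPf ->; by case: ifP; rewrite // mulr0.
rewrite big1 // => m Qm; case: eqP => [mk|_]; last by rewrite mulr0.
by rewrite mk (negPf Qk) in Qm.
Qed.

Lemma unit_partP p : nilcoef (p - unit_part p).
Proof.
have [[M0 _ _] _ _] := local_max_prime.
move=> m; rewrite mcoeffB mcoeff_partial_sum.
by case: asboolP => /=; rewrite ?subr0 ?subrr.
Qed.

Lemma unit_part_lead p : ~ nilcoef p ->
  ~ local_max (unit_part p)@_(mlead (unit_part p)).
Proof.
have [[M0 _ _] _ _] := local_max_prime.
move=> np; have : unit_part p != 0.
  apply/eqP => u0; apply: np; have := unit_partP p.
  by rewrite u0 subr0.
rewrite -mleadc_eq0; set m := mlead _; rewrite mcoeff_partial_sum.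
by case: asboolP => //=; rewrite eqxx.
Qed.

Lemma nilcoef_prime : prime_ideal nilcoef.
Proof.
have [M0 M1 Mprime] := local_max_prime; have [P0 PD PM] := nilcoef_ideal.
split=> //; first by move/(_ 0%MM); rewrite mcoeff1 eqxx.
move=> p q pq; apply: contrapT => /not_orP[np nq].
have : nilcoef (unit_part p * unit_part q).
  have -> : unit_part p * unit_part q =
    p * q + (- p * (q - unit_part q) + (- unit_part q) * (p - unit_part p)) by ring.
  by apply: (PD) => //; apply: (PD); apply: PM; apply: unit_partP.
move=> /(_ (mlead (unit_part p) + mlead (unit_part q))%MM).
by rewrite mleadcM => /Mprime[]; apply: unit_part_lead.
Qed.

Lemma mpoly_nil (p : A) : (forall m, nil_elt p@_m) -> nil_elt p.
Proof.
move=> pn; rewrite [p]mpolyE; apply: nilp_sum => m _.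
rewrite -mul_mpolyC; apply: nilpMr; have [k pk] := pn m; exists k.
by rewrite -rmorphXn /= pk mpolyC0.
Qed.

End Dim.

(** After the change of variables, the monomial of largest weight among those
    with unit coefficient dominates the others, so [h] is, up to a unit, a monic
    polynomial [q] plus a nilpotent [nu]; then [h] divides a power of [q]. *)
Lemma noether_multiple d (h : {mpoly R[d.+1]}) : ~ nilcoef h ->
  exists N p y, p \is monic /\
    e%:MP%:P * p = e%:MP%:P * (noether R d N h * y).
Proof.
move=> nh; pose N := (msize h).+1; pose T := noether R d N.
pose U m := ~~ `[< local_max h@_m >].
have [k /[!mem_filter]/andP[Uk kh] kmax] : exists2 k, k \in [seq m <- msupp h | U m] &
    forall m, m \in [seq m <- msupp h | U m] -> (noether_weight N m <= noether_weight N k)%N.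
  move: nh => /existsNP[m hm]; apply: (@seq_argmax _ _ _ m).
  rewrite mem_filter /U; apply/andP; split; first exact/asboolPn.
  rewrite mcoeff_msupp; apply/eqP => h0; apply: hm; rewrite h0.
  by have [[M0]] := local_max_prime.
have [v hv] : exists v, e * h@_k * v = e by apply: local_max_unit; apply/asboolPn.
have kmax' m : m \in msupp h -> U m -> m != k ->
    (noether_weight N m < noether_weight N k)%N.
  move=> mh Um mk; rewrite ltn_neqAle kmax ?mem_filter ?Um // andbT.
  apply: contra mk => /eqP wmk; apply/eqP/mnmP.
  apply: (base_expansion_inj (N := N)) wmk => i.
    rewrite ltnS (leq_trans _ (ltnW (msize_mdeg_lt mh))) //.
    by rewrite mdegE (bigD1 i) //= leq_addr.
  rewrite ltnS (leq_trans _ (ltnW (msize_mdeg_lt kh))) //.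
  by rewrite mdegE (bigD1 i) //= leq_addr.
have Tmono m : monic_deg (noether_weight N m) (T 'X_[m]) by apply: noether_monomial.
pose w m : {poly {mpoly R[d]}} := (v * h@_m)%:MP%:P * T 'X_[m].
pose q := T 'X_[k] + \sum_(m <- msupp h | (m != k) && U m) w m.
have qm : q \is monic.
  have [km ks] := Tmono k.
  have small : (size (\sum_(m <- msupp h | (m != k) && U m) w m)%R < size (T 'X_[k]))%N.
    rewrite ks ltnS (leq_trans (size_sum _ _ _)) //.
    rewrite big_seq_cond; apply/bigmax_leqP_seq => m mh /andP[_ /andP[mk Um]].
    rewrite /w mul_polyC (leq_trans (size_scale_leq _ _)) // (Tmono m).2.
    exact: kmax'.
  by rewrite monicE /q lead_coefDl.
pose nu := \sum_(m <- msupp h | ~~ U m) e%:MP%:P * w m.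
have nun : nil_elt nu.
  apply: nilp_sum => m; rewrite negbK => /asboolP[j hj].
  exists j; rewrite /w mulrA -!rmorphM /= exprMn -!rmorphXn /=.
  by rewrite mulrCA exprMn hj mulr0 !rmorph0 mul0r.
have Th : e%:MP%:P * (v%:MP%:P * T h) = e%:MP%:P * q + nu.
  have Tterm m : T (h@_m *: 'X_[m]) = (h@_m)%:MP%:P * T 'X_[m].
    by rewrite -mul_mpolyC rmorphM /T noetherC.
  have wE m : w m = v%:MP%:P * T (h@_m *: 'X_[m]).
    by rewrite Tterm /w !rmorphM mulrA.
  have sumT : e%:MP%:P * (v%:MP%:P * T h) = \sum_(m <- msupp h) e%:MP%:P * w m.
    rewrite {1}[h]mpolyE rmorph_sum mulr_sumr mulr_sumr.
    by apply: eq_bigr => m _; rewrite wE.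
  have wk : e%:MP%:P * w k = e%:MP%:P * T 'X_[k].
    have -> : e%:MP%:P * w k = (e%:MP * (v * h@_k)%:MP)%:P * T 'X_[k].
      by rewrite /w polyCM mulrA.
    by rewrite -mpolyCM mulrCA mulrA [v * e]mulrC [e * v * _]mulrAC hv.
  rewrite sumT /nu (bigID U) /=; congr (_ + _).
  rewrite [LHS](bigD1_seq_cond _ (msupp_uniq h) kh Uk) [RHS]mulrDr.
  by congr (_ + _); [exact: wk | rewrite [RHS]mulr_sumr].
have [[|j] nuj] := nun; first by move/eqP: nuj; rewrite expr0 oner_eq0.
pose x := e%:MP%:P * (v%:MP%:P * T h).
(* [e q ^+ j.+1] is [(x - nu) ^+ j.+1], which is a multiple of [x] because
   [nu ^+ j.+1 = 0]. *)
exists N, (q ^+ j.+1), (v%:MP%:P * \sum_(i < j.+1) (x - nu) ^+ (j - i) * (- nu) ^+ i).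
split; first exact: monic_exp.
have EE : e%:MP%:P * e%:MP%:P = e%:MP%:P :> {poly {mpoly R[d]}}.
  by rewrite -!rmorphM /= ee.
have EX i : e%:MP%:P ^+ i.+1 = e%:MP%:P :> {poly {mpoly R[d]}}.
  by elim: i => // i IHi; rewrite exprS IHi.
have -> : e%:MP%:P * q ^+ j.+1 = (x - nu) ^+ j.+1.
  by rewrite /x Th addrK exprMn EX.
have := subrXX (x - nu) (- nu) j.+1.
rewrite opprK subrK [in X in _ - X]exprNn nuj mulr0 subr0 => ->.
by rewrite /x -EE; ring.
Qed.

(** A polynomial outside the kernel divides a monic polynomial after a change of
    variables, or is a unit of [e R] if there is no variable. *)
Lemma nilcoef_regular d (s c : {mpoly R[d]}) : ~ nilcoef s ->
  e%:MP * (s * c) = 0 -> e%:MP * c = 0.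
Proof.
case: d s c => [|d] s c ns sc0.
  have sE := nvar0_mpolyC s; set k := s@_0%MM in sE.
  have [u ku] : exists u, e * k * u = e.
    apply: local_max_unit => kn; apply: ns => m.
    by rewrite sE mcoeffC; case: eqP => _; rewrite ?mulr1 // mulr0 /local_max mulr0; exact: nilp0.
  rewrite -ku !rmorphM /= -sE.
  have -> : e%:MP * s * u%:MP * c = u%:MP * (e%:MP * (s * c)) by ring.
  by rewrite sc0 mulr0.
have [N [p [y [pm ep]]]] := noether_multiple ns.
apply: (can_inj (@noetherK R d N)); rewrite rmorph0; apply: (monic_lreg pm).
rewrite mulr0 rmorphM noetherC mulrA [p * _]mulrC ep.
have swap (t u v w : {poly {mpoly R[d]}}) : t * (u * v) * w = v * (t * (u * w)).
  by ring.
rewrite swap -(@noetherC R d N e).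
have := congr1 (noether R d N) sc0; rewrite rmorphM rmorphM rmorph0 => ->.
exact: mulr0.
Qed.

End LocalPolynomials.

(** * Noether normalization of quotients by regular sequences *)

Section LocalModules.
Variables (R : comNzRingType) (e : R).
Hypotheses (eloc : local_idem e) (etn : tnilp e) (en0 : e <> 0).
Variables (S : comNzRingType) (iota : {rmorphism R -> S}).

Let ee : e * e = e. Proof. by case: eloc. Qed.

(** Otherwise every nonzero element of [e R] has a nonzero multiple by an element
    of the maximal ideal, which contradicts T-nilpotence. *)
Lemma socle_exists :
  exists z, [/\ z <> 0, e * z = z & forall c, local_max e c -> c * z = 0].
Proof.
apply: contrapT => nz.
have step z : exists c, z <> 0 -> e * z = z -> local_max e c /\ c * z <> 0.
  apply: contrapT => /forallNP nc; apply: nz; exists z; split.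
  - by move=> z0; apply: (nc 0) => /(_ z0).
  - by apply: contrapT => ez; apply: (nc 0) => _ /ez.
  by move=> c cm; apply: contrapT => cz; apply: (nc c).
have [f fP] := choice step.
pose st k := iter k (fun z => f z * z) e.
have stP k : st k <> 0 /\ e * st k = st k.
  elim: k => [//|k [k0 ek]]; rewrite [st k.+1]iterS; have [_ fk] := fP _ k0 ek.
  by split=> //; rewrite mulrCA ek.
have [k|k ek] := etn (a := fun k => f (st k)).
  by have [k0 ek] := stP k; have [] := fP _ k0 ek.
apply: (stP k).1; rewrite -ek; elim: k {ek} => [|k IHk].
  by rewrite big_ord0 mulr1.
by rewrite big_ord_recr /= mulrA -IHk mulrC.
Qed.

Section Module.
Variables (d : nat) (phi : {rmorphism {mpoly R[d]} -> S}) (B : lmodType S).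
Hypotheses (phiC : forall c, phi c%:MP = iota c)
  (Bfin : finmod phi B) (Bflat : flatmod e%:MP phi B)
  (eB : forall x : B, iota e *: x = x).

Local Notation nilspan := (prime_span (@nilcoef R e d) phi (B := B)).

Lemma scale_phi_eq c c' (x : B) : e%:MP * c = e%:MP * c' -> phi c *: x = phi c' *: x.
Proof.
move=> cc'; rewrite -[LHS]eB -[RHS]eB !scalerA -!phiC.
have := congr1 phi cc'; rewrite rmorphM rmorphM => ->.
by [].
Qed.

Lemma phi_regular s (x : B) : ~ nilcoef e s -> phi s *: x = 0 -> x = 0.
Proof.
move=> ns sx0; have [L [c [y [-> ec]]]] := flatmod1 Bflat sx0.
rewrite big1 // => l _; rewrite (@scale_phi_eq _ 0) ?rmorph0 ?scale0r // mulr0.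
exact: nilcoef_regular ns (ec l).
Qed.

(** A socle element [z] of [e R] has annihilator the maximal ideal, so
    multiplication by [z] identifies [B / m B] with [z B], on which a regular
    element stays regular. *)
Lemma regular_mod_nil g (x : B) :
  (forall y : B, g *: y = 0 -> y = 0) -> nilspan (g *: x) -> nilspan x.
Proof.
move=> greg [K [u [w [un gx]]]]; have [z [z0 ez mz]] := socle_exists.
have zu c : nilcoef e c -> z%:MP * c = 0 :> {mpoly R[d]}.
  move=> cn; apply/mpolyP => m; rewrite mcoeffCM mcoeff0 mulrC.
  exact/mz/cn.
have zx : phi z%:MP *: x = 0.
  apply: greg; rewrite scalerA mulrC -scalerA gx scaler_sumr big1 // => i _.
  by rewrite scalerA -rmorphM zu ?rmorph0 ?scale0r.
have [L [c [y [xc ec]]]] := flatmod1 Bflat zx.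
exists L, c, y; split=> // l m; apply: contrapT => nm.
have [v cv] := local_max_unit eloc nm.
have := congr1 (mcoeff m) (ec l); rewrite !mcoeffCM mcoeff0 mulrA ez => zc.
apply: z0; rewrite -ez -cv.
have -> : e * (c l)@_m * v * z = v * e * (z * (c l)@_m) by ring.
by rewrite zc mulr0.
Qed.

Lemma nilspan_nil (x : B) : nilspan x ->
  exists (K : finType) (u : K -> {mpoly R[d]}) (w : K -> B),
    (forall i m, nil_elt (u i)@_m) /\ x = \sum_i phi (u i) *: w i.
Proof.
move=> [K [u [w [un ->]]]]; exists K, (fun i => e%:MP * u i), w; split.
  by move=> i m; rewrite mcoeffCM; apply: un.
apply: eq_bigr => i _; apply: scale_phi_eq.
by rewrite mulrA -rmorphM /= ee.
Qed.

Variable b0 : B.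
Hypothesis b0gen : forall x, exists s : S, x = s *: b0.

(** The cyclic module [B] is a quotient ring of [S] with unit [b0], and [m B] is
    a nil ideal of it. *)
Lemma nilspan_nilpotent s : nilspan (s *: b0) -> exists k, s ^+ k *: b0 = 0.
Proof.
move=> /nilspan_nil[K [u [w [un sw]]]]; have [t tP] := choice (fun i => b0gen (w i)).
pose nu := \sum_i phi (u i) * t i.
have snu : s *: b0 = nu *: b0.
  rewrite sw scaler_suml; apply: eq_bigr => i _.
  by rewrite {1}tP scalerA.
have [k nuk] : nil_elt nu.
  apply: nilp_sum => i _; apply: nilpMr; have [k uk] := mpoly_nil (un i).
  by exists k; rewrite -rmorphXn /= uk rmorph0.
exists k; have -> : s ^+ k *: b0 = nu ^+ k *: b0.
  elim: k {nuk} => [//|k IHk].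
  by rewrite exprS -scalerA IHk scalerA mulrC -scalerA snu scalerA -exprSr.
by rewrite nuk scale0r.
Qed.

Let Pp : prime_ideal (@nilcoef R e d). Proof. exact: nilcoef_prime. Qed.

(** A dependence relation among [p 0 *: b0], ..., [p r *: b0] modulo [m], started
    at its first coefficient outside [m A]. *)
Lemma first_dependence (p : nat -> S) :
  exists r (i : 'I_r.+1) (s : 'I_r.+1 -> {mpoly R[d]}), ~ nilcoef e (s i) /\
    nilspan (phi (s i) *: (p i *: b0) +
             \sum_(j < r.+1 | (i < j)%N) phi (s j) *: (p j *: b0)).
Proof.
have [r dep] := finmod_dependence Pp Bfin.
have [s [[i0 si0] sP]] := dep (fun i => p i *: b0); exists r.
have [|i /asboolPn si imin] :=
  @arg_minnP _ i0 (fun i => ~~ `[< nilcoef e (s i) >]) (@nat_of_ord _).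
  exact/asboolPn.
exists i, s; split=> //.
have [sub0 subl] := prime_span_submodule (@nilcoef R e d) phi B.
have small (j : 'I_r.+1) : (j < i)%N -> nilspan (phi (s j) *: (p j *: b0)).
  move=> ji; apply: prime_span1; apply: contrapT => /asboolPn /imin.
  by rewrite leqNgt ji.
have smallsum : nilspan (\sum_(j < r.+1 | (j < i)%N) phi (s j) *: (p j *: b0)).
  elim/big_rec: _ => [|j x ji xn]; first exact: sub0.
  by rewrite -[_ *: (p j *: b0)]scale1r; apply: (subl) => //; apply: small.
have := subl (-1) _ _ smallsum sP; congr nilspan.
rewrite scaleN1r [X in _ + X](bigID (fun j : 'I_r.+1 => (j < i)%N)) /= addKr.
rewrite (bigD1 i) ?ltnn //=; congr (_ + _); apply: eq_bigl => j.
by rewrite -leqNgt ltn_neqAle andbC eq_sym.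
Qed.

(** Linear dependence of the partial products gives the chain condition
    modulo nilpotents up to a regular denominator. *)
Lemma chain_stable (a : nat -> S) :
  exists n s c, ~ nilcoef e s /\
    nilspan (phi s *: (\prod_(i < n) a i *: b0) -
             c *: (\prod_(i < n.+1) a i *: b0)).
Proof.
have [r [i [s [si sP]]]] := first_dependence (fun k => \prod_(j < k) a j).
pose C j := \prod_(i.+1 <= l < j) a l.
have CP j : (i < j)%N -> \prod_(l < j) a l = C j * \prod_(l < i.+1) a l.
  move=> ij; rewrite mulrC -(big_mkord predT) -(big_mkord predT).
  by rewrite -big_cat_nat.
exists i, (s i), (- \sum_(j < r.+1 | (i < j)%N) phi (s j) * C j); split=> //.
move: sP; congr nilspan; rewrite scaleNr opprK; congr (_ + _).
rewrite scaler_suml; apply: eq_bigr => j ij.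
by rewrite (CP _ ij) !scalerA mulrA.
Qed.

(** In a dependence among the powers of [g], the lowest power of [g] cancels by
    [regular_mod_nil]; so [g] divides the first coefficient up to an element of
    [m B], and divides a power of it. *)
Lemma regular_multiple g : (forall y : B, g *: y = 0 -> y = 0) ->
  exists h y, ~ nilcoef e h /\ forall x : B, phi h *: x = (g * y) *: x.
Proof.
move=> greg; have [r [i [s [si sP]]]] := first_dependence (fun k => g ^+ k).
pose t := \sum_(j < r.+1 | (i < j)%N) phi (s j) * g ^+ (j - i.+1).
have gi k x : nilspan (g ^+ k *: x) -> nilspan x.
  elim: k => [|k IHk]; first by rewrite scale1r.
  by rewrite exprS -scalerA => /(regular_mod_nil greg).
have /gi/nilspan_nilpotent[k] : nilspan (g ^+ i *: ((phi (s i) + g * t) *: b0)).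
  move: sP; congr nilspan; rewrite scalerDl scalerDr !scalerA; congr (_ + _).
    by rewrite mulrC.
  rewrite mulr_sumr mulr_sumr scaler_suml; apply: eq_bigr => j ij.
  rewrite scalerA -{1}(subnKC ij) exprD exprS; congr (_ *: _); ring.
have [y xy] : exists y, (phi (s i) + g * t) ^+ k = phi (s i) ^+ k - g * y.
  elim: k => [|k [y IHk]]; first by exists 0; rewrite mulr0 subr0.
  rewrite exprS IHk; exists (phi (s i) * y - t * phi (s i) ^+ k + g * t * y).
  by rewrite [in RHS]exprS; ring.
rewrite xy => h0; exists (s i ^+ k), y; split.
  have [_ P1 Pprime] := Pp; elim: k {xy h0} => [|k IHk]; first exact: P1.
  by rewrite exprS => /Pprime[].
move=> x; have [u ->] := b0gen x; apply/eqP; rewrite -subr_eq0 -scalerBl.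
by rewrite rmorphXn scalerA mulrC -scalerA h0 scaler0.
Qed.

End Module.

(** A Noether normalization of the [e R]-module [B], with [d] variables. *)
Definition normalized d (B : lmodType S) : Prop :=
  exists phi : {rmorphism {mpoly R[d]} -> S},
    [/\ forall c, phi c%:MP = iota c, finmod phi B & flatmod e%:MP phi B].

Section Step.
Variables (B B' : lmodType S) (q : {linear B -> B'}) (g : S) (b0 : B).
Hypotheses (qsurj : forall y, exists x, q x = y)
  (qker : forall x, q x = 0 <-> exists y, x = g *: y)
  (eB : forall x : B, iota e *: x = x)
  (b0gen : forall x, exists s : S, x = s *: b0)
  (greg : forall x : B, g *: x = 0 -> x = 0).

Lemma normalized_step d : normalized d.+1 B -> normalized d B'.
Proof.
move=> [phi [phiC Bfin Bflat]].
have [h [y [hn hP]]] := regular_multiple phiC Bfin Bflat eB b0gen greg.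
have [N [p [z [pm pz]]]] := noether_multiple eloc en0 hn.
pose psi : {rmorphism {poly {mpoly R[d]}} -> S} := phi \o noether_inv R d N.
pose psi0 : {rmorphism {mpoly R[d]} -> S} := psi \o polyC.
have psiE x : psi x = phi (noether_inv R d N x) by [].
have psi0C c : psi0 c%:MP = iota c.
  rewrite -[LHS]/(phi (noether_inv R d N c%:MP%:P)).
  by rewrite noether_invC noether_oldC.
have epsi (x : B) : psi e%:MP%:P *: x = x.
  by have := eB x; rewrite -psi0C.
have psip (x : B) : psi p *: x = (g * (y * psi z)) *: x.
  rewrite -(epsi x) !scalerA -!(mulrC (psi e%:MP%:P)) -[in LHS]rmorphM pz.
  rewrite rmorphM rmorphM [psi (noether R d N h)]psiE noetherK.
  rewrite -!scalerA; congr (_ *: _); rewrite scalerA mulrC -scalerA hP.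
  by rewrite !scalerA; congr (_ *: _); ring.
have psifin : finmod psi B.
  have [K [w wP]] := Bfin; exists K, w => x; have [a ->] := wP x.
  exists (fun i => noether R d N (a i)); apply: eq_bigr => i _.
  by rewrite psiE noetherK.
have psiflat : flatmod e%:MP%:P psi B.
  move=> K a b ab; have [L [c [w [bc ec]]]] := Bflat K (fun i => noether_inv R d N (a i)) b ab.
  exists L, (fun i l => noether R d N (c i l)), w; split=> [i|l].
    by rewrite bc; apply: eq_bigr => l _; rewrite psiE noetherK.
  have := congr1 (noether R d N) (ec l).
  rewrite rmorphM noetherC rmorph_sum rmorph0 => el; apply: etrans el.
  by congr (_ * _); apply: eq_bigr => i _; rewrite rmorphM noether_invK.
exists psi0; split=> //.
  exact: (quotient_finmod qsurj qker pm psip).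
exact: (quotient_flatmod qsurj qker pm psip epsi).
Qed.

Lemma normalized0_regular_surj : normalized 0 B -> forall x : B, exists y, x = g *: y.
Proof.
move=> [phi [phiC Bfin Bflat]] x.
have [h [y [hn hP]]] := regular_multiple phiC Bfin Bflat eB b0gen greg.
have hE := nvar0_mpolyC h; set k := h@_0%MM in hE.
have [u ku] : exists u, e * k * u = e.
  apply: local_max_unit => // kn; apply: hn => m.
  by rewrite hE mcoeffC; case: eqP => _; rewrite ?mulr1 // mulr0 /local_max mulr0; exact: nilp0.
exists (y *: (iota u *: x)).
rewrite -[LHS]eB scalerA -hP hE phiC -{1}ku !rmorphM -[in RHS](eB x) !scalerA.
by congr (_ *: _); ring.
Qed.

End Step.
End LocalModules.

Section Extend.
Variables (R : comNzRingType) (e : R).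
Hypotheses (eloc : local_idem e) (en0 : e <> 0).
Variables (S : comNzRingType) (iota : {rmorphism R -> S}).
Variables (B : lmodType S) (b0 : B).
Hypotheses (eB : forall x : B, iota e *: x = x)
  (b0gen : forall x, exists s : S, x = s *: b0).

Lemma coef1_notin_nilcoef d (p : {mpoly R[d]}) m : p@_m = 1 -> ~ nilcoef e p.
Proof.
by have [_ M1 _] := local_max_prime eloc en0; move=> pm /(_ m); rewrite pm.
Qed.

(** By the determinant trick, if a variable acts surjectively on the finite
    module [B] then [B] is killed by a polynomial with constant term [1], which
    is regular on [B]. *)
Lemma normalized_variable d : normalized e iota d.+1 B -> b0 <> 0 ->
  exists x : S, (forall y : B, x *: y = 0 -> y = 0) /\
    forall u : S, b0 <> (x * u) *: b0.
Proof.
move=> [phi [phiC Bfin Bflat]] b00.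
have preg := phi_regular eloc en0 phiC Bflat eB.
exists (phi 'X_ord0); split=> [y|u b0u].
  by apply: preg; apply: (coef1_notin_nilcoef (m := U_(ord0))); rewrite mcoeffXU eqxx.
have [K [w wP]] := Bfin.
have Xu (x : B) : x = (phi 'X_ord0 * u) *: x.
  by have [t ->] := b0gen x; rewrite scalerA mulrC -scalerA -b0u.
have [a aP] := choice (fun i => wP (u *: w i)).
pose k := #|K|; pose v (i : 'I_k) := w (enum_val i).
pose M : 'M[{mpoly R[d.+1]}]_k :=
  1%:M - 'X_ord0 *: \matrix_(i, j) a (enum_val i) (enum_val j).
have Mv i : \sum_j phi (M i j) *: v j = 0.
  under eq_bigr do rewrite !mxE rmorphB rmorphM scalerBl.
  rewrite sumrB (bigD1 i) //= eqxx rmorph1 scale1r big1 ?addr0 => [|j /negPf ij].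
    apply/eqP; rewrite subr_eq0; apply/eqP.
    under eq_bigr do rewrite -scalerA.
    rewrite -scaler_sumr {1}[v i]Xu -scalerA; congr (_ *: _).
    rewrite /v aP (reindex (enum_val (A := predT))) //=.
    exact/onW_bij/enum_val_bij.
  by rewrite eq_sym ij rmorph0 scale0r.
have detv j : phi (\det M) *: v j = 0.
  have : \sum_i phi (\adj M j i) *: (\sum_l phi (M i l) *: v l) = 0.
    by rewrite big1 // => i _; rewrite Mv scaler0.
  under eq_bigr do rewrite scaler_sumr; rewrite exchange_big /=.
  rewrite (bigD1 j) //= [X in _ + X]big1 => [|l /negPf lj]; last first.
    under eq_bigr do rewrite scalerA -rmorphM.
    rewrite -scaler_suml -rmorph_sum.
    have -> : \sum_i \adj M j i * M i l = (\adj M *m M) j l by rewrite mxE.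
    by rewrite mul_adj_mx mxE eq_sym lj rmorph0 scale0r.
  under eq_bigr do rewrite scalerA -rmorphM.
  rewrite -scaler_suml -rmorph_sum addr0.
  have -> : \sum_i \adj M j i * M i j = (\adj M *m M) j j by rewrite mxE.
  by rewrite mul_adj_mx mxE eqxx.
apply: b00; apply: (preg (\det M)).
  apply: (coef1_notin_nilcoef (m := 0%MM)); rewrite -[LHS]det_map_mx.
  suff -> : map_mx (mcoeff 0%MM) M = 1%:M by rewrite det1.
  apply/matrixP => i j; rewrite !mxE mcoeffB.
  have -> : ('X_ord0 * a (enum_val i) (enum_val j))@_0%MM = 0.
    rewrite rmorphM /= mcoeffX.
    by rewrite mnm1_eq0 mul0r.
  by rewrite subr0; case: eqP; rewrite ?mcoeff1 ?eqxx ?mcoeff0.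
have [c ->] := wP b0; rewrite scaler_sumr big1 // => i _.
rewrite scalerA mulrC -scalerA -[i]enum_rankK.
by rewrite -/(v _) detv scaler0.
Qed.

End Extend.

Section IdealGen.
Variable A : comNzRingType.
Implicit Types (s : seq A).

Lemma ideal_genS (s t : set A) : s `<=` t -> ideal_gen s `<=` ideal_gen t.
Proof. by move=> st x sx J [Jid tJ]; apply: sx; split=> //; apply: subset_trans tJ. Qed.

Lemma ideal_gen_sub (s : set A) : s `<=` ideal_gen s.
Proof. by move=> x sx J [_]; apply. Qed.

Lemma ideal_gen_min (s I : set A) : is_ideal I -> s `<=` I -> ideal_gen s `<=` I.
Proof. by move=> Iid sI x; apply. Qed.

Lemma ideal_gen_nil x : ideal_gen [set` ([::] : seq A)] x <-> x = 0.
Proof.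
split; last by move=> ->; have [I0] := ideal_gen_is_ideal [set` ([::] : seq A)].
apply: (@ideal_gen_min _ [set 0]) => [|y] /=; last by rewrite in_nil.
by split=> [//|y z -> -> /=|a y -> /=]; rewrite ?addr0 ?mulr0.
Qed.

Lemma ideal_gen_rcons s g x : ideal_gen [set` rcons s g] x <->
  exists y, ideal_gen [set` s] (x - g * y).
Proof.
have Iid := ideal_gen_is_ideal [set` s]; split.
  have [Qid IQ Qg] := ideal_adjoinP g Iid.
  move=> xg; have : ideal_adjoin (ideal_gen [set` s]) g x.
    apply: (ideal_gen_min Qid) xg => y /=; rewrite mem_rcons inE => /orP[/eqP -> //|ys].
    by apply: IQ; apply: ideal_gen_sub.
  by move=> [y [u [Iy ->]]]; exists u; rewrite addrK.
move=> [y xy]; have [_ D M] := ideal_gen_is_ideal [set` rcons s g].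
rewrite -[x](subrK (g * y)); apply: D.
  by apply: ideal_genS xy => z /=; rewrite mem_rcons inE orbC => ->.
by rewrite mulrC; apply: M; apply: ideal_gen_sub => /=; rewrite mem_rcons mem_head.
Qed.

End IdealGen.

Section RegularQuotient.
Variables (R : comNzRingType) (n : nat) (e : R).
Hypotheses (eloc : local_idem e) (etn : tnilp e).
Local Notation S := {mpoly R[n]}.
Local Notation E := (e%:MP : S).

Let EE : E * E = E. Proof. by rewrite -rmorphM /= (proj1 eloc). Qed.

(** A regular sequence without the condition that the ideal be proper, since
    that condition may fail on one of the local pieces. *)
Definition weakly_regular (s : seq S) : Prop := forall j, (j < size s)%N ->
  forall a, ideal_gen [set` take j s] (s`_j * a) -> ideal_gen [set` take j s] a.

(** [B] is the [e]-part of [S / I]. *)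
Definition presents (I : set S) (B : lmodType S) (p : {linear S^o -> B}) : Prop :=
  (forall y, exists x, p x = y) /\ forall x, p x = 0 <-> I (E * x).

Lemma presents_cyclic (I : set S) (B : lmodType S) (p : {linear S^o -> B}) :
  is_ideal I -> presents I p ->
  (forall x : B, E *: x = x) /\ (forall x : B, exists t : S, x = t *: p 1).
Proof.
move=> [I0 _ _] [psurj pker]; split=> x; have [y <-] := psurj x.
  apply/eqP; rewrite -subr_eq0 -linearZ -linearB; apply/eqP/pker.
  have -> : E * (E *: (y : S^o) - y) = E * E * y - E * y.
    by rewrite mulrBr mulrA.
  by rewrite EE subrr.
by exists y; rewrite -linearZ; congr (p _); rewrite /GRing.scale /= mulr1.
Qed.

(** Noether normalization for the quotients by the initial segments; once all
    [n] variables are exhausted, the [e]-part is zero. *)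
Lemma weakly_regular_normalized s j : e <> 0 -> weakly_regular s -> (j <= size s)%N ->
  exists (B : lmodType S) (p : {linear S^o -> B}),
    presents (ideal_gen [set` take j s]) p /\
    if (j <= n)%N then normalized e (@mpolyC n R) (n - j) B else forall x : B, x = 0.
Proof.
move=> en0 sreg; elim: j => [|j IHj] js.
  have Ksub : submodule (fun x : S^o => E * x = 0).
    by split=> [|a x y x0 y0]; rewrite ?mulr0 // mulrDr y0 addr0 /GRing.scale /= mulrCA x0 mulr0.
  have [B [p [psurj pker]]] := quotient_module_exists Ksub.
  exists B, p; split; first by split=> // x; rewrite pker take0 ideal_gen_nil.
  rewrite leq0n subn0; exists idfun; split=> //.
    exists unit, (fun=> p 1) => x; have [s0 <-] := psurj x; exists (fun=> s0).
    rewrite (big_pred1 tt) => [|[] //].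
    by rewrite -linearZ; congr (p _); rewrite /GRing.scale /= mulr1.
  move=> K a b' ab0; have [b bP] := choice (fun i => psurj (b' i)).
  exists unit, (fun i _ => b i), (fun=> p 1); split=> [i|_].
    rewrite (big_pred1 tt) => [|[] //]; rewrite -bP -linearZ; congr (p _).
    by rewrite /GRing.scale /= mulr1.
  apply/pker; rewrite linear_sum -[RHS]ab0; apply: eq_bigr => i _.
  by rewrite -bP -linearZ.
have [B [p [[psurj pker] Bnorm]]] := IHj (ltnW js).
have Iid := ideal_gen_is_ideal [set` take j s].
have [eB b0gen] := presents_cyclic Iid (conj psurj pker).
have greg (x : B) : s`_j *: x = 0 -> x = 0.
  have [y <-] := psurj x; rewrite -linearZ => /pker h; apply/pker.
  by apply: (sreg j js); rewrite mulrCA.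
have gsub : submodule (fun x : B => exists y, x = s`_j *: y).
  split; first by exists 0; rewrite scaler0.
  move=> a _ _ [y ->] [z ->]; exists (a *: y + z).
  by rewrite scalerDr !scalerA mulrC.
have [B' [q [qsurj qker]]] := quotient_module_exists gsub.
have pl : linear (fun x : S^o => q (p x)) by move=> a x y; rewrite !linearP.
exists B', (linear_map pl); split.
  split=> [y|x]; first by have [z <-] := qsurj y; have [x <-] := psurj z; exists x.
  rewrite /= qker (take_nth 0 js) ideal_gen_rcons; have [_ ID IM] := Iid; split.
    move=> [y pxy]; have [z zy] := psurj y; exists (E * z).
    have -> : E * x - s`_j * (E * z) = E * (x - s`_j * z) by ring.
    by apply/pker; rewrite linearB pxy -zy -linearZ subrr.
  move=> [y exy]; exists (p y); apply/eqP; rewrite -linearZ -subr_eq0 -linearB.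
  apply/eqP/pker; have -> : E * (x - s`_j *: (y : S^o)) = E * (E * x - s`_j * y).
    by rewrite [RHS]mulrBr (mulrA E E x) EE -mulrBr.
  exact: IM.
move: Bnorm; rewrite leq_eqVlt; case: eqP => [->|_] /=.
  rewrite subnn ltnn => Bnorm x; have [y <-] := qsurj x; apply/qker.
  exact: (normalized0_regular_surj eloc etn en0 eB b0gen greg Bnorm).
case: ifP => jn Bnorm.
  move: Bnorm; rewrite -(subnSK jn).
  exact: (normalized_step eloc etn en0 qsurj qker eB b0gen greg).
by move=> x; have [y <-] := qsurj x; rewrite [y]Bnorm linear0.
Qed.

Definition nilpoly (f : S) : Prop := forall m, nil_elt f@_m.

Lemma nilspan_nilpoly d (phi : {rmorphism {mpoly R[d]} -> S}) (B : lmodType S)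
    (p : {linear S^o -> B}) (x : B) :
  (forall c, phi c%:MP = c%:MP) -> (forall x : B, E *: x = x) ->
  (forall y, exists x, p x = y) -> prime_span (@nilcoef R e d) phi x ->
  exists2 f, nilpoly f & x = p f.
Proof.
move=> phiC eB psurj xn.
have [K [u [w [un ->]]]] := nilspan_nil eloc phiC eB xn.
have [t tP] := choice (fun i => psurj (w i)).
have nilpolyM f g : nilpoly f -> nilpoly (f * g).
  by move=> fn m; rewrite mcoeffM; apply: nilp_sum => k _; apply/nilpMr/fn.
exists (\sum_i phi (u i) * t i).
  move=> m; rewrite raddf_sum; apply: nilp_sum => i _ /=; apply: nilpolyM => {}m.
  rewrite [u i]mpolyE rmorph_sum raddf_sum; apply: nilp_sum => k _ /=.
  by rewrite -mul_mpolyC rmorphM phiC /= mcoeffCM; apply/nilpMr/un.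
rewrite linear_sum; apply: eq_bigr => i _.
by rewrite -tP -linearZ.
Qed.

Lemma regular_too_long s : weakly_regular s -> (n < size s)%N ->
  ideal_gen [set` s] E.
Proof.
move=> sreg ns; have [->|/eqP en0] := eqVneq e 0.
  by rewrite mpolyC0; have [] := ideal_gen_is_ideal [set` s].
have [B [p [[_ pker]]]] := weakly_regular_normalized en0 sreg (leqnn _).
rewrite leqNgt ns take_size in pker * => B0.
by have /pker := B0 (p 1); rewrite mulr1.
Qed.

(** The chain condition of [S / I] up to the denominator [t], which is regular on
    the [e]-part, and up to the nilpotent error [f]. *)
Lemma regular_chain s (a : nat -> S) : weakly_regular s -> (size s <= n)%N ->
  exists k t c f, [/\ nilpoly f,
    ideal_gen [set` s] (E * (t * \prod_(i < k) a i - c * \prod_(i < k.+1) a i - f))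
    & forall x, ideal_gen [set` s] (E * (t * x)) -> ideal_gen [set` s] (E * x)].
Proof.
move=> sreg sn; have Iid := ideal_gen_is_ideal [set` s].
have [e0|/eqP en0] := eqVneq e 0.
  have I0 : ideal_gen [set` s] 0 by case: Iid.
  exists 0%N, 0, 0, 0; rewrite e0 mpolyC0; split=> [m||x _]; rewrite ?mul0r //.
  by rewrite mcoeff0; exact: nilp0.
have [B [p [pP]]] := weakly_regular_normalized en0 sreg (leqnn _).
rewrite sn take_size in pP * => -[phi [phiC Bfin Bflat]].
have [eB b0gen] := presents_cyclic Iid pP; have [psurj pker] := pP.
have pE (x : S) : p x = x *: p 1.
  by rewrite -linearZ; congr (p _); rewrite /GRing.scale /= mulr1.
have [k [t [c [tn tc]]]] := chain_stable eloc en0 Bfin (p 1) a.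
have [f fn xf] := nilspan_nilpoly phiC eB psurj tc.
exists k, (phi t), c, f; split=> // [|x tx]; apply/pker.
  by rewrite [LHS]pE scalerBl scalerBl -!scalerA xf pE subrr.
apply: (phi_regular eloc en0 phiC Bflat eB tn).
by rewrite -linearZ; apply/pker.
Qed.

Lemma regular_extend s : weakly_regular s -> (size s < n)%N ->
  ~ ideal_gen [set` s] E ->
  exists x, (forall y, ideal_gen [set` s] (E * (x * y)) -> ideal_gen [set` s] (E * y))
    /\ forall u, ~ ideal_gen [set` s] (E * (1 - x * u)).
Proof.
move=> sreg sn nE; have Iid := ideal_gen_is_ideal [set` s].
have en0 : e <> 0.
  by move=> e0; apply: nE; rewrite e0 mpolyC0; case: Iid.
have [B [p [pP]]] := weakly_regular_normalized en0 sreg (leqnn _).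
rewrite (ltnW sn) take_size -(subnSK sn) in pP * => Bnorm.
have [eB b0gen] := presents_cyclic Iid pP; have [psurj pker] := pP.
have pE (x : S) : p x = x *: p 1.
  by rewrite -linearZ; congr (p _); rewrite /GRing.scale /= mulr1.
have [|x [xreg xu]] := normalized_variable eloc en0 eB b0gen Bnorm.
  by move=> /pker; rewrite mulr1.
exists x; split=> [y xy|u /pker].
  by apply/pker/xreg; rewrite -linearZ; apply/pker.
rewrite linearB => /eqP; rewrite subr_eq0 => /eqP b0u.
by apply: (xu u); rewrite -pE.
Qed.

End RegularQuotient.

(** * Products of finitely generated nil ideals *)

Section Koenig.
Variables (A : comNzRingType) (s : nat -> seq A).

(** In the tree whose levels are the lists [s i], the element [y] placed at level
    [j] vanishes along every branch after [k] steps. *)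
Definition killed j (y : A) k : Prop :=
  forall g : nat -> A, (forall i, (i < k)%N -> g i \in s (j + i)%N) ->
    y * \prod_(i < k) g i = 0.

Lemma killedS j y k l : (k <= l)%N -> killed j y k -> killed j y l.
Proof.
move=> kl yk g gs; rewrite -(subnKC kl) big_split_ord mulrA /=.
by rewrite yk ?mul0r // => i ik; apply/gs/(leq_trans ik).
Qed.

Lemma killed_cons j y k a : a \in s j -> killed j y k.+1 -> killed j.+1 (y * a) k.
Proof.
move=> aj yk g gs.
have := yk (fun i => if i is i'.+1 then g i' else a).
rewrite big_ord_recl mulrA /=; apply=> -[_|i ik]; first by rewrite addn0.
by rewrite addnS -addSn; apply: gs.
Qed.

(** Koenig's lemma.  If [y] is not killed by any number of lists, then neither is
    [y * a] for some [a] of the first list, because this list is finite. *)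
Lemma koenig_killed :
  (forall a : nat -> A, (forall i, a i \in s i) -> exists n, \prod_(i < n) a i = 0) ->
  exists k, killed 0 1 k.
Proof.
move=> sprod; apply: contrapT => nk.
pose alive (p : nat * A) := forall k, ~ killed p.1 p.2 k.
have step p : exists a, alive p -> a \in s p.1 /\ alive (p.1.+1, p.2 * a).
  apply: contrapT => /forallNP na.
  have allk a : a \in s p.1 -> exists k, killed p.1.+1 (p.2 * a) k.
    move=> ap; apply: contrapT => nka; apply: (na a) => _; split=> // k ka.
    by apply: nka; exists k.
  have [k kP] : exists k, forall a, a \in s p.1 -> killed p.1.+1 (p.2 * a) k.
    elim: (s p.1) allk => [|b t IHt] allk; first by exists 0%N.
    have [|k kP] := IHt; first by move=> a at_; apply: allk; rewrite inE at_ orbT.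
    have [l lP] := allk b (mem_head _ _).
    exists (maxn k l) => a; rewrite inE => /orP[/eqP ->|/kP].
      exact: killedS (leq_maxr _ _) lP.
    exact: killedS (leq_maxl _ _).
  have [] := na 0 => pal; case: (pal k.+1) => g gs.
  have g0 : g 0%N \in s p.1 by have := gs 0%N isT; rewrite addn0.
  rewrite big_ord_recl mulrA; apply: (kP _ g0 (fun i => g i.+1)) => i ik.
  by rewrite addSn -addnS; apply: gs.
have [f fP] := choice step.
pose st k := iter k (fun p => (p.1.+1, p.2 * f p)) (0%N, 1 : A).
have st1 k : (st k).1 = k by elim: k => //= k ->.
have stal k : alive (st k).
  elim: k => [|k IHk]; first by move=> k kk; apply: nk; exists k.
  by rewrite [st k.+1]iterS; apply: (fP _ _).2.
have [i|n an] := sprod (fun k => f (st k)).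
  by rewrite -{2}[i]st1; apply: (fP _ (stal i)).1.
have st2 k : (st k).2 = \prod_(i < k) f (st i).
  by elim: k => [|k IHk]; rewrite ?big_ord0 // big_ord_recr -IHk.
by apply: (stal n 0%N) => g _; rewrite st2 an mul0r.
Qed.

(** Lets a vanishing that holds for generators extend to the ideal. *)
Lemma annihilator_ideal (y : A) (P : set A) :
  is_ideal [set x | forall z, P z -> y * (x * z) = 0].
Proof.
split=> [z _|x x' xP xP' z Pz|a x xP z Pz] /=; first by rewrite mul0r mulr0.
  by rewrite mulrDl mulrDr xP ?xP' ?addr0.
by rewrite -mulrA mulrCA xP ?mulr0.
Qed.

Lemma killed_prod (f : nat -> A) k : (forall i, ideal_gen [set` s i] (f i)) ->
  killed 0 1 k -> \prod_(i < k) f i = 0.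
Proof.
move=> fs k1; rewrite -[LHS]mul1r.
suff gen j y : killed j y k -> y * \prod_(i < k) f (j + i)%N = 0.
  by have := gen _ _ k1; under eq_bigr do rewrite add0n.
elim: k j y {k1} => [|k IHk] j y yk.
  by have := yk f; rewrite !big_ord0; apply.
rewrite big_ord_recl addn0.
apply: (ideal_gen_min (annihilator_ideal y [set \prod_(i < k) f (j.+1 + i)%N]) _ (fs j)).
  by move=> a /= aj _ ->; rewrite mulrA; apply/IHk/killed_cons.
by apply: eq_bigr => i _; rewrite /= addnS addSn.
Qed.

Lemma killed_ideal_mul (I : nat -> set A) k : (forall i, I i = ideal_gen [set` s i]) ->
  killed 0 1 k -> \big[@ideal_mul A/[set: A]]_(i < k) I i = [set 0].
Proof.
move=> Is k1.
suff gen j y x : killed j y k ->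
    (\big[@ideal_mul A/[set: A]]_(i < k) I (j + i)%N) x -> y * x = 0.
  apply/seteqP; split=> [x xI|_ ->].
    by rewrite /= -[x]mul1r; apply: (gen 0%N).
  case: k {k1 gen} => [|k]; first by rewrite big_ord0.
  by rewrite big_ord_recl; have [] := ideal_gen_is_ideal
    [set u * v | u in I 0%N & v in \big[@ideal_mul A/[set: A]]_(i < k) I (lift ord0 i)].
elim: k j y x {k1} => [|k IHk] j y x yk.
  by move=> _; have := yk (fun=> 0); rewrite big_ord0 mulr1 => ->; rewrite ?mul0r.
rewrite big_ord_recl => xI.
have shift : \big[@ideal_mul A/[set: A]]_(i < k) I (j + lift ord0 i)%N =
    \big[@ideal_mul A/[set: A]]_(i < k) I (j.+1 + i)%N.
  by apply: eq_bigr => i _; rewrite /= /bump /= addnA addn1.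
rewrite shift in xI; have -> : y * x = y * (x * 1) by rewrite mulr1.
apply: (ideal_gen_min (annihilator_ideal y [set 1]) _ xI) => //= _ [u Iu [v Iv <-]] _ ->.
have uj : ideal_gen [set` s j] u by move: Iu; rewrite Is addn0.
rewrite mulr1; set rest := \big[_/_]_(i < k) _ in Iv.
suff sub : [set` s j] `<=` [set u | forall z, rest z -> y * (u * z) = 0].
  exact: (ideal_gen_min (annihilator_ideal y rest) sub uj) Iv.
move=> a /= aj z Iz.
by rewrite mulrA; apply: (IHk j.+1) => //; apply: killed_cons.
Qed.

End Koenig.

(** Koenig's lemma for the lists of coefficients. *)
Lemma nil_tnilp_nilpoly (R : comNzRingType) n (f : nat -> {mpoly R[n]}) :
  nil_tnilp R -> (forall i, nilpoly (f i)) -> exists k, \prod_(i < k) f i = 0.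
Proof.
move=> Rt fn; pose s i := [seq ((f i)@_m)%:MP_[n] | m <- msupp (f i)].
have [a as_|k kP] := @koenig_killed _ s.
  have aE i : exists c : R, nil_elt c /\ a i = c%:MP_[n].
    by have /mapP[m _ ->] := as_ i; exists (f i)@_m; split=> //; apply: fn.
  have [c cP] := choice aE.
  have [k ck] := Rt c (fun i => (cP i).1); exists k.
  rewrite (eq_bigr (fun i : 'I_k => (c i)%:MP)) => [|i _]; last exact: (cP i).2.
  by rewrite -rmorph_prod /= ck mpolyC0.
exists k; apply: killed_prod kP => i.
have [I0 ID IM] := ideal_gen_is_ideal [set` s i].
rewrite [f i]mpolyE big_seq; elim/big_rec: _ => // m x mf Ix; apply: ID => //.
rewrite -mul_mpolyC mulrC; apply: IM; apply: ideal_gen_sub => /=.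
exact: map_f.
Qed.

(** * Total quotient rings *)

Section TotalQuotientMap.
Variable A : comNzRingType.
Import TotalQuotient.

Definition to_total_quotient (x : A) : total_quotient A :=
  \pi_(TotalQuotient.type A) (frac_of x (@GRing.lreg1 A)).

Lemma to_total_quotientB : zmod_morphism to_total_quotient.
Proof.
move=> x y; rewrite /to_total_quotient.
rewrite -[_ - _ in RHS]/(TotalQuotient.add _ (TotalQuotient.opp _)) -pi_opp -pi_add.
by apply/eqmodP/eqP => /=; ring.
Qed.

Lemma to_total_quotientM : monoid_morphism to_total_quotient.
Proof.
split=> [|x y]; first by rewrite /to_total_quotient; apply/eqP; rewrite piE.
rewrite /to_total_quotient -[_ * _ in RHS]/(TotalQuotient.mul _ _) -pi_mul.
by apply/eqmodP/eqP => /=; ring.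
Qed.

HB.instance Definition _ :=
  GRing.isZmodMorphism.Build A (total_quotient A) to_total_quotient to_total_quotientB.
HB.instance Definition _ :=
  GRing.isMonoidMorphism.Build A (total_quotient A) to_total_quotient to_total_quotientM.

Lemma to_total_quotient_eq0 x : to_total_quotient x = 0 -> x = 0.
Proof.
rewrite -(rmorph0 to_total_quotient) => /eqmodP/eqP /=.
by rewrite mulr1 mulr0.
Qed.

Lemma to_total_quotient_unit s : GRing.lreg s -> exists u, to_total_quotient s * u = 1.
Proof.
move=> sreg; exists (\pi_(TotalQuotient.type A) (frac_of 1 sreg)).
rewrite -(rmorph1 to_total_quotient) /to_total_quotient.
rewrite -[_ * _]/(TotalQuotient.mul _ _) -pi_mul.
by apply/eqmodP/eqP => /=; ring.
Qed.

Lemma to_total_quotient_frac (q : total_quotient A) :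
  exists a s, GRing.lreg s /\ q * to_total_quotient s = to_total_quotient a.
Proof.
elim/quotW: q => x; exists (val x).1, (val x).2; split; first exact: den_lreg.
rewrite /to_total_quotient -[_ * _]/(TotalQuotient.mul _ _) -pi_mul.
by apply/eqmodP/eqP => /=; ring.
Qed.

End TotalQuotientMap.

Section QuotientRingMap.
Variables (A : comNzRingType) (I : set A).
Hypotheses (idI : is_ideal I) (properI : ~ I 1).

Lemma quotient_ring_exists : exists p : {rmorphism A -> quotient_ring idI properI},
  (forall y, exists x, p x = y) /\ forall x, p x = 0 <-> I x.
Proof.
exists \pi_(quotient_ring idI properI); split=> [y|x].
  by exists (repr y); apply: reprK.
rewrite -(rmorph0 \pi_(quotient_ring idI properI)).
split=> [/eqmodP|Ix].
  by rewrite /= /Quotient.equiv subr0 => /asboolP.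
by apply/eqmodP; rewrite /= /Quotient.equiv subr0; apply/asboolP.
Qed.

End QuotientRingMap.

(** * Perfection of the rings of fractions *)

Lemma local_decomp_sum (C : comNzRingType) (es : seq C) :
  (forall e, e \in es -> exists s, local_decomp e s) ->
  exists s, local_decomp (\sum_(e <- es) e) s.
Proof.
elim: es => [|e es IHes] esP.
  by exists [::]; rewrite big_nil; split=> [|x]; rewrite ?big_nil ?in_nil.
have [s [se sP]] := esP e (mem_head _ _).
have [|t [te tP]] := IHes; first by move=> x xes; apply: esP; rewrite inE xes orbT.
exists (s ++ t); split; first by rewrite big_cat big_cons /= se te.
by move=> x; rewrite mem_cat => /orP[/sP|/tP].
Qed.

Section Fractions.
Variables (R : comNzRingType) (n : nat) (es : seq R).
Hypotheses (Rt : nil_tnilp R) (esP : local_decomp 1 es).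
Local Notation S := {mpoly R[n]}.
Variables (s : seq S) (sreg : weakly_regular s) (sn : (size s <= n)%N).
Local Notation I := (ideal_gen [set` s]).

Definition regular_mod (t : S) : Prop := forall x, I (t * x) -> I x.

Variables (Q : comNzRingType) (kappa : {rmorphism S -> Q}).
Hypotheses (kker : forall x, kappa x = 0 <-> I x)
  (kunit : forall t, regular_mod t -> exists u, kappa t * u = 1)
  (kfrac : forall q, exists a t, regular_mod t /\ q * kappa t = kappa a).

Let Iid : is_ideal I. Proof. exact: ideal_gen_is_ideal. Qed.

Lemma regular_modM t u : regular_mod t -> regular_mod u -> regular_mod (t * u).
Proof. by move=> tr ur x; rewrite -mulrA => /tr/ur. Qed.

(** A denominator for the [e]-part becomes one for the whole quotient when it is
    completed by [1] on the complementary part. *)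
Lemma regular_mod_glue e t : e * e = e ->
  (forall x, I (e%:MP * (t * x)) -> I (e%:MP * x)) ->
  regular_mod (e%:MP * t + (1 - e%:MP)).
Proof.
move=> ee tr x Ix; have [_ ID IM] := Iid.
have EE : e%:MP * e%:MP = e%:MP :> S by rewrite -rmorphM /= ee.
have Ex : I (e%:MP * x).
  apply: tr; have -> : e%:MP * (t * x) = e%:MP * ((e%:MP * t + (1 - e%:MP)) * x).
    have -> : e%:MP * ((e%:MP * t + (1 - e%:MP)) * x) =
      e%:MP * e%:MP * (t * x) + (e%:MP - e%:MP * e%:MP) * x by ring.
    by rewrite EE subrr mul0r addr0.
  exact: IM.
have -> : x = e%:MP * x + (1 - e%:MP) * ((e%:MP * t + (1 - e%:MP)) * x).
  have -> : e%:MP * x + (1 - e%:MP) * ((e%:MP * t + (1 - e%:MP)) * x) =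
    x + (e%:MP - e%:MP * e%:MP) * (t * x) - (e%:MP - e%:MP * e%:MP) * x by ring.
  by rewrite EE subrr !mul0r subr0 addr0.
by apply: ID => //; apply: IM.
Qed.

(** The ideal of [Q] generated by the nilpotents of [R]. *)
Definition nilfrac : set Q := fun q =>
  exists t f, [/\ regular_mod t, nilpoly f & q * kappa t = kappa f].

Lemma nilpolyMl (g f : S) : nilpoly f -> nilpoly (g * f).
Proof.
by move=> fn m; rewrite mcoeffM; apply: nilp_sum => k _; apply/nilpMl/fn.
Qed.

Lemma nilfracM x y : nilfrac y -> nilfrac (x * y).
Proof.
move=> [t [f [tr fn yt]]]; have [a [u [ur xu]]] := kfrac x.
exists (u * t), (a * f); split; [exact: regular_modM | exact: nilpolyMl |].
by rewrite !rmorphM -xu -yt; ring.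
Qed.

Lemma nilfrac_tnilp (q : nat -> Q) :
  (forall i, nilfrac (q i)) -> exists k, \prod_(i < k) q i = 0.
Proof.
move=> /choice[t /choice[f tfP]].
have fn i : nilpoly (f i) by have [] := tfP i.
have [k fk] := nil_tnilp_nilpoly Rt fn; exists k.
have [u tu] : exists u, kappa (\prod_(i < k) t i) * u = 1.
  apply: kunit; elim/big_rec: _ => [x|i x _ xr]; first by rewrite mul1r.
  by apply: regular_modM => //; have [] := tfP i.
have qt : \prod_(i < k) q i * kappa (\prod_(i < k) t i) = kappa (\prod_(i < k) f i).
  by rewrite !rmorph_prod -big_split; apply: eq_bigr => i _; have [] := tfP i.
have -> : \prod_(i < k) q i = \prod_(i < k) q i * kappa (\prod_(i < k) t i) * u.
  by rewrite -mulrA tu mulr1.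
by rewrite qt fk rmorph0 mul0r.
Qed.

Lemma fraction_dcc e : e \in es -> dcc_mod nilfrac (kappa e%:MP).
Proof.
move=> ees a; have [eloc etn] := esP.2 e ees.
have /choice[b /choice[t bt]] := fun i => kfrac (a i).
have [k [v [c [f [fn kf vr]]]]] := regular_chain eloc etn b sreg sn.
pose w := e%:MP * v + (1 - e%:MP); pose T j := \prod_(i < j) t i.
have wr : regular_mod w by apply: regular_mod_glue => //; case: eloc.
have [u wu] := kunit wr.
(* Here [a i] is the fraction of numerator [b i] and denominator [t i]; [u] is
   the inverse of the completed denominator [w]. *)
exists k, (kappa (c * t k) * u), (w * T k), (e%:MP * f); split.
- apply: regular_modM => //; rewrite /T; elim/big_rec: _ => [x|i x _ xr].
    by rewrite mul1r.
  by apply: regular_modM => //; have [] := bt i.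
- exact: nilpolyMl.
have aT j : \prod_(i < j) a i * kappa (T j) = kappa (\prod_(i < j) b i).
  by rewrite !rmorph_prod -big_split; apply: eq_bigr => i _; have [] := bt i.
have ew : kappa e%:MP * kappa w = kappa (e%:MP * v).
  rewrite -rmorphM; congr (kappa _).
  have -> : e%:MP * w = e%:MP * e%:MP * v + (e%:MP - e%:MP * e%:MP).
    by rewrite /w; ring.
  by rewrite -rmorphM /= (proj1 eloc) subrr addr0.
have TS : kappa (T k) * kappa (t k) = kappa (T k.+1).
  by rewrite -rmorphM /T big_ord_recr.
set P := \prod_(i < k) a i; set P1 := \prod_(i < k.+1) a i.
have -> : kappa e%:MP * (P - P1 * (kappa (c * t k) * u)) * kappa (w * T k) =
   (kappa e%:MP * kappa w) * (P * kappa (T k)) -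
   kappa e%:MP * kappa c * (P1 * (kappa (T k) * kappa (t k))) * (kappa w * u).
  by rewrite !rmorphM; ring.
rewrite ew wu mulr1 TS !aT -!rmorphM -rmorphB.
apply/eqP; rewrite -subr_eq0 -rmorphB; apply/eqP/kker.
move: kf; congr I; ring.
Qed.

Lemma fraction_perfect : perfect Q.
Proof.
have [d dP] : exists s, local_decomp (\sum_(e <- map (fun e => kappa e%:MP) es) e) s.
  apply: local_decomp_sum => _ /mapP[e ees ->].
  apply: (dcc_mod_local_decomp nilfracM nilfrac_tnilp); last exact: fraction_dcc.
  by rewrite -!rmorphM /=; have [[-> _] _] := esP.2 e ees.
apply: (local_decomp_perfect (s := d)).
suff e1 : \sum_(e <- map (fun e => kappa e%:MP) es) e = 1 by rewrite -e1.
by rewrite big_map -!rmorph_sum esP.1 !rmorph1.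
Qed.

End Fractions.

(** * The four conditions *)

(** Stated for an injection [f] to cover at once [R] itself and the total quotient
    rings. *)
Lemma perfect_nil_tnilp (R Q : comNzRingType) (f : {rmorphism R -> Q}) :
  (forall x, f x = 0 -> x = 0) -> perfect Q -> nil_tnilp R.
Proof.
move=> finj Qperf a an.
have [n [c]] := perfect_dcc (fun i => f (a i)) Qperf.
rewrite big_ord_recr /=; set P := \prod_(i < n) f (a i) => Pc.
exists n; apply: finj; rewrite rmorph_prod -/P.
have fan : nil_elt (f (a n)).
  by have [k ak] := an n; exists k; rewrite -rmorphXn /= ak rmorph0.
have [y cy] := nilp_unit (nilpMr c fan).
have -> : P = (P - P * f (a n) * c) * y.
  by rewrite -{1}[P]mulr1 -cy; ring.
by rewrite -Pc subrr mul0r.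
Qed.

Section Subperfect.
Variables (R : comNzRingType) (n : nat) (es : seq R).
Hypotheses (Rt : nil_tnilp R) (esP : local_decomp 1 es).
Local Notation S := {mpoly R[n]}.

Lemma subperfect_mpoly : subperfect S.
Proof.
have nil0 x : ideal_gen [set` ([::] : seq S)] x <-> x = 0 := ideal_gen_nil x.
apply: (fraction_perfect Rt esP (s := [::]) _ _
  (kappa := to_total_quotient (A := S) : {rmorphism S -> total_quotient S})) => //.
- move=> x; rewrite nil0; split; first exact: to_total_quotient_eq0.
  by move=> ->; rewrite rmorph0.
- move=> t tr; apply: to_total_quotient_unit => x y txy.
  apply/eqP; rewrite -subr_eq0; apply/eqP; rewrite -nil0.
  by apply: tr; rewrite nil0 mulrBr txy subrr.
move=> q; have [a [t [tr qt]]] := to_total_quotient_frac q; exists a, t; split=> //.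
by move=> x; rewrite !nil0 => tx; apply: tr; rewrite tx mulr0.
Qed.

Lemma subperfect_regular_quotient (s : seq S) (idI : is_ideal (ideal_gen [set` s]))
    (properI : ~ ideal_gen [set` s] 1) :
  weakly_regular s -> (size s <= n)%N -> subperfect (quotient_ring idI properI).
Proof.
move=> sreg sn; have [p [psurj pker]] := quotient_ring_exists idI properI.
have [I0 ID IM] := idI.
have preg t : GRing.lreg (p t) <-> regular_mod s t.
  split=> [tr x|tr y y'].
    by rewrite -!pker rmorphM => tx; apply: tr; rewrite mulr0.
  have [x <-] := psurj y; have [x' <-] := psurj y'.
  move=> /eqP; rewrite -subr_eq0 -mulrBr -rmorphB -rmorphM => /eqP/pker/tr/pker.
  by rewrite rmorphB => /eqP; rewrite subr_eq0 => /eqP.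
pose kappa : {rmorphism S -> total_quotient (quotient_ring idI properI)} :=
  to_total_quotient (A := quotient_ring idI properI) \o p.
apply: (fraction_perfect Rt esP sreg sn (kappa := kappa)).
- move=> x; rewrite -pker; split; first exact: to_total_quotient_eq0.
  by move=> px; rewrite /kappa /= px rmorph0.
- by move=> t /preg/to_total_quotient_unit.
move=> q; have [y [z [zr qz]]] := to_total_quotient_frac q.
have [a ya] := psurj y; have [t zt] := psurj z; exists a, t.
by split; [apply/preg; rewrite zt | rewrite /kappa /= ya zt].
Qed.

Lemma regular_sequence_size (s : seq S) : regular_sequence s -> (size s <= n)%N.
Proof.
move=> [s1 sreg]; rewrite leqNgt; apply/negP => ns; apply: s1.
have [I0 ID _] := ideal_gen_is_ideal [set` s].
have <- : \sum_(e <- es) e%:MP = 1 :> S by rewrite -rmorph_sum /= esP.1.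
rewrite big_seq; elim/big_rec: _ => // e x ees Ix; apply: ID => //.
have [eloc etn] := esP.2 e ees; exact: (@regular_too_long _ _ _ eloc etn s sreg ns).
Qed.

Lemma regular_sequence_extend (s : seq S) :
  regular_sequence s -> (size s < n)%N -> exists x, regular_sequence (rcons s x).
Proof.
move=> [s1 sreg] sn; have [I0 ID IM] := ideal_gen_is_ideal [set` s].
have [e ees nE] : exists2 e, e \in es & ~ ideal_gen [set` s] e%:MP.
  apply: contrapT => nE; apply: s1.
  have <- : \sum_(e <- es) e%:MP = 1 :> S by rewrite -rmorph_sum /= esP.1.
  rewrite big_seq; elim/big_rec: _ => // e x ees Ix; apply: ID => //.
  by apply: contrapT => ne; apply: nE; exists e.
have [eloc etn] := esP.2 e ees; have ee := proj1 eloc.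
have [x [xreg xu]] := regular_extend eloc etn sreg sn nE.
have wreg := regular_mod_glue ee xreg.
exists (e%:MP * x + (1 - e%:MP)); split.
  move=> /ideal_gen_rcons[u Iu]; apply: (xu u).
  have -> : e%:MP * (1 - x * u) = e%:MP * (1 - (e%:MP * x + (1 - e%:MP)) * u).
    have -> : e%:MP * (1 - (e%:MP * x + (1 - e%:MP)) * u) =
      e%:MP - e%:MP * e%:MP * (x * u) - (e%:MP - e%:MP * e%:MP) * u by ring.
    by rewrite -rmorphM /= ee subrr mul0r subr0 mulrBr mulr1.
  exact: IM.
move=> j; rewrite size_rcons ltnS leq_eqVlt => /orP[/eqP ->|js] a.
  by rewrite -cats1 take_size_cat // nth_cat ltnn subnn /=; apply: wreg.
rewrite -cats1 takel_cat ?(ltnW js) // nth_cat js.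
exact: sreg.
Qed.

Lemma n_subperfect_mpoly : n_subperfect n S.
Proof.
split=> [s sreg|s [sreg smax]].
  apply: subperfect_regular_quotient (regular_sequence_size sreg).
  by case: sreg.
apply/eqP; rewrite eqn_leq regular_sequence_size // leqNgt; apply/negP => sn.
by have [x /smax] := regular_sequence_extend sreg sn.
Qed.

End Subperfect.

Lemma subperfect_nil_tnilp (R : comNzRingType) n :
  subperfect {mpoly R[n]} -> nil_tnilp R.
Proof.
apply: (perfect_nil_tnilp
  (f := to_total_quotient (A := {mpoly R[n]}) \o @mpolyC n R)) => x.
by move=> /to_total_quotient_eq0/eqP; rewrite mpolyC_eq0 => /eqP.
Qed.

Lemma regularly_subperfect_nil_tnilp (R : comNzRingType) n :
  regularly_subperfect {mpoly R[n]} -> nil_tnilp R.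
Proof.
move=> Sreg.
have nilreg : regular_sequence ([::] : seq {mpoly R[n]}).
  by split=> // /ideal_gen_nil/eqP; rewrite oner_eq0.
have := Sreg _ nilreg; set properI := proj1 nilreg; set idI := ideal_gen_is_ideal _.
have [p [_ pker]] := quotient_ring_exists idI properI.
apply: (perfect_nil_tnilp (f := to_total_quotient (A := quotient_ring idI properI)
  \o (p \o @mpolyC n R))) => x.
move=> /to_total_quotient_eq0/pker/ideal_gen_nil/eqP.
by rewrite mpolyC_eq0 => /eqP.
Qed.

Section IdealProducts.
Variable R : comNzRingType.

Definition products_vanish : Prop := forall I : nat -> set R,
  (forall i, is_ideal (I i) /\ finitely_generated (I i) /\
             I i `<=` jacobson_radical R) ->
  exists k, (0 < k)%N /\ \big[@ideal_mul R/[set: R]]_(i < k) I i = [set 0].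

Lemma prod_in_ideal_mul (a : nat -> R) (I : nat -> set R) k :
  (forall i, I i (a i)) ->
  (\big[@ideal_mul R/[set: R]]_(i < k) I i) (\prod_(i < k) a i).
Proof.
elim: k a I => [|k IHk] a I aI; first by rewrite !big_ord0.
rewrite !big_ord_recl; apply: ideal_gen_sub.
exists (a 0%N); first exact: aI.
exists (\prod_(i < k) a i.+1) => //.
exact: (IHk (fun i => a i.+1) (fun i => I i.+1)).
Qed.

Hypothesis R0 : has_krull_dim R 0.

Lemma products_vanish_nil_tnilp : products_vanish -> nil_tnilp R.
Proof.
move=> Rprod a an; have [i|k [_ kI]] := Rprod (fun i => ideal_gen [set` [:: a i]]).
  split; first exact: ideal_gen_is_ideal; split; first by exists [:: a i].
  rewrite (dim0_jacobson R0); apply: ideal_gen_min => [|x /=].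
    split=> [|x y|b x]; [exact: nilp0 | exact: nilpD | exact: nilpMl].
  by rewrite inE => /eqP ->.
exists k; have := prod_in_ideal_mul k (a := a) (I := fun i => ideal_gen [set` [:: a i]]).
rewrite kI; apply=> i; apply: ideal_gen_sub => /=; exact: mem_head.
Qed.

Lemma nil_tnilp_products_vanish : nil_tnilp R -> products_vanish.
Proof.
move=> Rt I IP; have [s sP] := choice (fun i => (IP i).2.1).
have [a as_|k kP] := @koenig_killed _ s.
  apply: Rt => i; suff : jacobson_radical R (a i) by rewrite (dim0_jacobson R0).
  by apply: (IP i).2.2; rewrite sP; apply: ideal_gen_sub; apply: as_.
by exists k.+1; split=> //; apply: (killed_ideal_mul sP); apply: killedS kP.
Qed.

End IdealProducts.

Theorem theorem6p2 (R : comNzRingType) (n : nat) :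
  semilocal R -> has_krull_dim R 0 ->
  [<-> perfect R;
       subperfect {mpoly R[n]};
       n_subperfect n {mpoly R[n]};
       forall I : nat -> set R,
         (forall i, is_ideal (I i) /\ finitely_generated (I i) /\
                    I i `<=` jacobson_radical R) ->
         exists k, (0 < k)%N /\
           \big[@ideal_mul R/[set: R]]_(i < k) I i = [set 0]].
Proof.
move=> Rs R0.
have tP : nil_tnilp R -> exists es : seq R, local_decomp 1 es.
  exact: semilocal_local_decomp.
tfae=> [Rperf|Rsub|[Rsub _]|/(products_vanish_nil_tnilp R0) Rt].
- have Rt : nil_tnilp R by apply: (perfect_nil_tnilp (f := idfun)) Rperf.
  by have [es esP] := tP Rt; apply: subperfect_mpoly esP.
- have Rt := subperfect_nil_tnilp Rsub.
  by have [es esP] := tP Rt; apply: n_subperfect_mpoly esP.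
- exact/(nil_tnilp_products_vanish R0)/regularly_subperfect_nil_tnilp/Rsub.
by have [es esP] := tP Rt; apply: local_decomp_perfect esP.
Qed.
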